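(* (i) For any indices $\mathbf{k}$ and $\mathbf{l}$, \[ \zeta_{q}^{\mathcal{S}}(\mathbf{k})\zeta_{q}^{\mathcal{S}}(\mathbf{l})=\sum_{\mathbf{m}}d_{\mathbf{k},\mathbf{l}}^{\, \ast, \mathbf{m}}\zeta_{q}^{\mathcal{S}}(\mathbf{m}) \] in $\mathcal Z_q/(\mathcal N_q+\mathcal P_q)$. (ii) If moreover at least one of $\mathbf{k}$ and $\mathbf{l}$ is admissible, then \[ (-1)^{\mathrm{wt}(\mathbf{l})}\zeta_{q}^{\mathcal{S}}(\mathbf{k}, \overline{\mathbf{l}})=\sum_{\mathbf{m}}d_{\mathbf{k},\mathbf{l}}^{\, \mathrm{sh}, \mathbf{m}}\zeta_{q}^{\mathcal{S}}(\mathbf{m}), \] where $(\mathbf k,\overline{\mathbf l})$ is the concatenation of $\mathbf k$ and $\overline{\mathbf l}$.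
   Context: Indices: an index is a finite (possibly empty) tuple $\mathbf k=(k_1,\dots,k_r)$ of positive integers, weight $\mathrm{wt}(\mathbf k)=\sum k_i$, reversal $\overline{\mathbf k}=(k_r,\dots,k_1)$; admissible if empty or $k_r\ge2$. Classical words: $\mathfrak h=\mathbb{Q}\langle x,y\rangle$, $z_k=yx^{k-1}$, $z_{\mathbf k}=z_{k_1}\cdots z_{k_r}$, $z_\varnothing=1$, $\mathfrak h^1=\mathbb Q+y\mathfrak h$. Harmonic product $\ast$ on $\mathfrak h^1$: $w\ast1=1\ast w=w$, $(wz_k)\ast(w'z_l)=(w\ast w'z_l)z_k+(wz_k\ast w')z_l+(w\ast w')z_{k+l}$; shuffle product $\mathrm{sh}$ on $\mathfrak h$: $w\,\mathrm{sh}\,1=1\,\mathrm{sh}\,w=w$, $(wu)\,\mathrm{sh}\,(w'v)=(w\,\mathrm{sh}\,w'v)u+(wu\,\mathrm{sh}\,w')v$ ($u,v\in\{x,y\}$). The non-negative integers $d^{\bullet,\mathbf m}_{\mathbf k,\mathbf l}$ ($\bullet\in\{\ast,\mathrm{sh}\}$) are defined by $z_{\mathbf k}\bullet z_{\mathbf l}=\sum_{\mathbf m}d^{\bullet,\mathbf m}_{\mathbf k,\mathbf l}z_{\mathbf m}$. $q$-side: Let $\mathcal{C}=\mathbb{Q}[\hbar]$ ($\hbar$ formal), $\mathfrak{H}=\mathcal{C}\langle a,b\rangle$. For $k\ge1$, $g_k=ba^k$, $e_k=b(a+\hbar)a^{k-1}$. $A=\{\hbar b\}\cup\{ba^k\mid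 k\ge1\}$, $\mathcal{C}\langle A\rangle$ the $\mathcal{C}$-subalgebra generated by $1$ and $A$, $\mathfrak z$ the $\mathcal C$-span of $A$, $\widehat{\mathfrak H^0}=\mathcal C+\sum_{k\ge1}\mathcal C\langle A\rangle g_k$. Fix $q\in\mathbb{C}$, $0<|q|<1$; $\mathbb{C}$ is a $\mathcal{C}$-module with $\hbar$ acting by $1-q$; $[m]=(1-q^m)/(1-q)$; $F_q(m;\cdot):\mathfrak{z}\to\mathbb{C}$ $\mathcal{C}$-linear with $F_q(m;\hbar b)=1-q$, $F_q(m;g_k)=q^{km}/[m]^k$; $Z_{q,M}$ $\mathcal{C}$-linear on $\mathcal C\langle A\rangle$ with $Z_{q,M}(1)=1$, $Z_{q,M}(u_1\cdots u_r)=\sum_{0<m_1<\cdots<m_r<M}\prod_i F_q(m_i;u_i)$ ($u_i\in A$); $Z_q(w)=\lim_{M\to\infty}Z_{q,M}(w)$ for $w\in\widehat{\mathfrak H^0}$. $\circ_\hbar$ symmetric $\mathcal C$-bilinear on $\mathfrak z$ with $(\hbar b)\circ_\hbar(\hbar b)=\hbar\cdot\hbar b$, $(\hbar b)\circ_\hbar g_k=\hbar g_k$, $g_k\circ_\hbar g_l=g_{k+l}$; $\ast_\hbar$ on $\mathcal{C}\langle A\rangle$: $w\ast_\hbar1=1\ast_\hbar w=w$, $(wu)\ast_\hbar(w'v)=(w\ast_\hbar w'v)u+(wu\ast_\hbar w')v+(w\ast_\hbar w')(u\circ_\hbar v)$ ($u,v\in A$). $\mathrm{sh}_\hbar$ on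 $\mathfrak H$: $w\,\mathrm{sh}_\hbar\,1=1\,\mathrm{sh}_\hbar\,w=w$, $wa\,\mathrm{sh}_\hbar\,w'a=(wa\,\mathrm{sh}_\hbar\,w'+w\,\mathrm{sh}_\hbar\,w'a+\hbar(w\,\mathrm{sh}_\hbar\,w'))a$, $wb\,\mathrm{sh}_\hbar\,w'=w\,\mathrm{sh}_\hbar\,w'b=(w\,\mathrm{sh}_\hbar\,w')b$. $\psi^\ast$: the $\mathcal C$-algebra anti-involution of $\mathcal C\langle A\rangle$ with $\psi^\ast(\hbar b)=\hbar b$, $\psi^\ast(ba^k)=b(-a)^k$. $w^{\mathcal S,\ast}_\hbar(1)=1$, $w^{\mathcal S,\ast}_\hbar(u_1\cdots u_r)=\sum_{i=0}^r(u_1\cdots u_i)\ast_\hbar\psi^\ast(u_{i+1}\cdots u_r)$ ($u_j\in A$), $\mathcal C$-linear; $Z^{\mathcal S,\ast}_{q,M}=Z_{q,M}\circ w^{\mathcal S,\ast}_\hbar$. $g_{\mathbf k}=g_{k_1}\cdots g_{k_r}$, $g_\varnothing=1$; $Z_q^{\mathcal S,\ast}(g_{\mathbf k})=\lim_{M\to\infty}Z^{\mathcal S,\ast}_{q,M}(g_{\mathbf k})$ (exists). Let $\mathfrak n_0$ be the $\mathcal C$-span of $(\hbar b)^{\alpha_1}g_{\beta_1+1}\cdots(\hbar b)^{\alpha_r}g_{\beta_r+1}$ with $r\ge1$, $\alpha_i,\beta_i\ge0$ and $\alpha_s\ge1,\beta_t\ge1$ for some $1\le s\le t\le r$; $\mathfrak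 n=\mathfrak n_0+\hbar\widehat{\mathfrak H^0}$; $\mathfrak H^0=\mathcal C+\sum_{k\ge2}\mathcal C\langle A\rangle g_k+\mathfrak n$; $\mathcal Z_q=Z_q(\mathfrak H^0)$, $\mathcal N_q=Z_q(\mathfrak n)$, $\mathcal P_q$ the ideal of $\mathcal Z_q$ generated by $\{Z_q(g_{2k})\mid k\ge1\}$. Define $\zeta_q^{\mathcal S}(\mathbf k)$ as the class of $Z_q^{\mathcal S,\ast}(g_{\mathbf k})$ in the ring $\mathcal Z_q/(\mathcal N_q+\mathcal P_q)$. *)

(* Defs.v *)
(* complex numbers are R[i] (mathcomp-real-closed) over an
   arbitrary R : realType, so R[i] is (a copy of) the field C. *)
From mathcomp Require Import all_boot all_order all_algebra.
From mathcomp Require Import reals complex.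
Set Implicit Arguments.
Unset Strict Implicit.
Unset Printing Implicit Defensive.
Import Order.TTheory GRing.Theory Num.Theory.
Local Open Scope ring_scope.

Definition index_pos (k : seq nat) : bool := all (fun n => 0 < n)%N k.
Definition wt (k : seq nat) : nat := sumn k.
Definition admissible (k : seq nat) : bool :=
  if k is [::] then true else (1 < last 0%N k)%N.

(* Harmonic product z_k * z_l, computed with the recursion on last
   letters, written on reversed indices.  The result is the list of
   indices m, each repeated d^{*,m}_{k,l} times. *)
Fixpoint harmR (x y : seq nat) {struct x} : seq (seq nat) :=
  match x with
  | [::] => [:: y]
  | u :: x' =>
    let fix harmR_in (y : seq nat) : seq (seq nat) :=
      match y with
      | [::] => [:: x]
      | v :: y' =>
          map (cons u) (harmR x' y) ++ map (cons v) (harmR_in y')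
          ++ map (cons (u + v)%N) (harmR x' y')
      end in harmR_in y
  end.

Definition harm (k l : seq nat) : seq (seq nat) :=
  map (@rev nat) (harmR (rev k) (rev l)).

Inductive xy := Lx | Ly.

Definition xy_eqb (u v : xy) : bool :=
  match u, v with Lx, Lx | Ly, Ly => true | _, _ => false end.

Definition zword (k : seq nat) : seq xy :=
  flatten [seq Ly :: nseq n.-1 Lx | n <- k].

(* shuffle product on reversed words (last-letter recursion) *)
Fixpoint shR (x y : seq xy) {struct x} : seq (seq xy) :=
  match x with
  | [::] => [:: y]
  | u :: x' =>
    let fix shR_in (y : seq xy) : seq (seq xy) :=
      match y with
      | [::] => [:: x]
      | v :: y' => map (cons u) (shR x' y) ++ map (cons v) (shR_in y')
      end in shR_in y
  end.

Definition sh (w w' : seq xy) : seq (seq xy) :=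
  map (@rev xy) (shR (rev w) (rev w')).

(* decode a word of h^1 starting with y (i.e. y x^{m_1-1} ... y x^{m_s-1})
   back into the index (m_1,...,m_s). *)
Definition decode (w : seq xy) : seq nat :=
  (foldr (fun u (st : nat * seq nat) =>
            match u with
            | Lx => (st.1.+1, st.2)
            | Ly => (0%N, st.1.+1 :: st.2)
            end) (0%N, [::]) w).2.

(* z_k sh z_l = sum_m d^{sh,m}_{k,l} z_m : list of the m's with multiplicity *)
Definition shuffle_idx (k l : seq nat) : seq (seq nat) :=
  map decode (sh (zword k) (zword l)).

(* q-side.  C<A> is the free C=Q[hbar]-algebra on A = {hbar b} u {g_k}  *)
(* (the map to Q[hbar]<a,b> is injective).  Letters:                   *)
(*   Hb  = hbar b,   G k = g_k = b a^k  (k >= 1).                       *)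
(* An element of C<A> is a formal sum of terms (c, e, w) meaning        *)
(* c * hbar^e * w, with c : rat, w a word in A.                         *)

Inductive Alet := Hb | G of nat.

Definition Alet_valid (u : Alet) : bool :=
  match u with Hb => true | G k => (0 < k)%N end.
Definition Aword_valid (w : seq Alet) : bool := all Alet_valid w.

Definition fs := seq (rat * nat * seq Alet).

(* u o_hbar v = hbar^e * letter *)
Definition circ (u v : Alet) : nat * Alet :=
  match u, v with
  | Hb, Hb => (1%N, Hb)
  | Hb, G k => (1%N, G k)
  | G k, Hb => (1%N, G k)
  | G k, G l => (0%N, G (k + l))
  end.

Definition fs_map_word (f : seq Alet -> seq Alet) (X : fs) : fs :=
  [seq (t.1.1, t.1.2, f t.2) | t <- X].
Definition fs_shift (e : nat) (X : fs) : fs :=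
  [seq (t.1.1, (t.1.2 + e)%N, t.2) | t <- X].

Fixpoint starR (x y : seq Alet) {struct x} : fs :=
  match x with
  | [::] => [:: (1%Q, 0%N, y)]
  | u :: x' =>
    let fix starR_in (y : seq Alet) : fs :=
      match y with
      | [::] => [:: (1%Q, 0%N, x)]
      | v :: y' =>
          fs_map_word (cons u) (starR x' y)
          ++ fs_map_word (cons v) (starR_in y')
          ++ fs_shift (circ u v).1 (fs_map_word (cons (circ u v).2) (starR x' y'))
      end in starR_in y
  end.

Definition star_word (w w' : seq Alet) : fs :=
  fs_map_word (@rev Alet) (starR (rev w) (rev w')).

Definition star_fs (X Y : fs) : fs :=
  flatten [seq [seq ((s.1.1 * t.1.1 * r.1.1)%R, (s.1.2 + t.1.2 + r.1.2)%N, r.2)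
               | r <- star_word s.2 t.2] | s <- X, t <- Y].

Definition psi_letter_sign (u : Alet) : rat :=
  match u with Hb => 1 | G k => (-1) ^+ k end.
Definition psi_word (w : seq Alet) : fs :=
  [:: (\prod_(u <- w) psi_letter_sign u, 0%N, rev w)].

Definition wS_word (w : seq Alet) : fs :=
  flatten [seq star_fs [:: (1%Q, 0%N, take i w)] (psi_word (drop i w))
          | i <- iota 0 (size w).+1].

Definition gword (k : seq nat) : seq Alet := map G k.

Section QSide.
Variable R : realType.
Local Notation C := R[i].
Variable q : C.

Definition qint (m : nat) : C := (1 - q ^+ m) / (1 - q).

Definition Fq (m : nat) (u : Alet) : C :=
  match u with
  | Hb => 1 - q
  | G k => q ^+ (k * m) / (qint m) ^+ k
  end.

(* sum over 0 < m_1 < ... < m_r < M, on the reversed word *)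
Fixpoint ZqMrev (rw : seq Alet) (M : nat) : C :=
  match rw with
  | [::] => 1
  | u :: rw' => \sum_(1 <= m < M) ZqMrev rw' m * Fq m u
  end.

Definition ZqM_word (w : seq Alet) (M : nat) : C := ZqMrev (rev w) M.

(* C-linear, hbar acting by 1 - q *)
Definition ZqM (X : fs) (M : nat) : C :=
  \sum_(t <- X) ratr t.1.1 * (1 - q) ^+ t.1.2 * ZqM_word t.2 M.

Definition cvg_to (u : nat -> C) (L : C) : Prop :=
  forall eps : C, 0 < eps -> exists N : nat, forall M : nat, (N <= M)%N ->
    `|u M - L| < eps.

Definition Zq_is (X : fs) (L : C) : Prop := cvg_to (ZqM X) L.

Definition ZSqM (k : seq nat) (M : nat) : C := ZqM (wS_word (gword k)) M.

End QSide.

(* ---- the subspaces, described through their monomials hbar^e w ---- *)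

(* \hat{H^0} = C + sum_{k>=1} C<A> g_k *)
Definition hatH0_word (w : seq Alet) : bool :=
  Aword_valid w &&
  (if w is [::] then true else if last Hb w is G k then (0 < k)%N else false).

Definition n0_gen (ab : seq (nat * nat)) : seq Alet :=
  flatten [seq rcons (nseq p.1 Hb) (G p.2.+1) | p <- ab].

Definition n0_cond (ab : seq (nat * nat)) : Prop :=
  (0 < size ab)%N /\
  exists s t : nat, (s <= t)%N /\ (t < size ab)%N /\
    (1 <= (nth (0, 0) ab s).1)%N /\ (1 <= (nth (0, 0) ab t).2)%N.

Definition n0_word (w : seq Alet) : Prop :=
  exists ab, n0_cond ab /\ w = n0_gen ab.

(* n = n_0 + hbar \hat{H^0} *)
Definition n_mono (e : nat) (w : seq Alet) : Prop :=
  n0_word w \/ ((1 <= e)%N /\ hatH0_word w).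

(* H^0 = C + sum_{k>=2} C<A> g_k + n *)
Definition H0_mono (e : nat) (w : seq Alet) : Prop :=
  w = [::] \/
  (Aword_valid w /\ exists w' k, w = rcons w' (G k) /\ (2 <= k)%N) \/
  n_mono e w.

Definition in_span (P : nat -> seq Alet -> Prop) (X : fs) : Prop :=
  foldr (fun t acc => P t.1.2 t.2 /\ acc) True X.

Section Rings.
Variable R : realType.
Local Notation C := R[i].
Variable q : C.

Definition Zq_set (z : C) : Prop :=
  exists X, in_span H0_mono X /\ Zq_is q X z.

Definition Nq_set (z : C) : Prop :=
  exists X, in_span n_mono X /\ Zq_is q X z.

Definition Pq_set (z : C) : Prop :=
  exists s : seq (C * C),
    (forall p, p \in s ->
       Zq_set p.1 /\ exists k, (1 <= k)%N /\ Zq_is q [:: (1%Q, 0%N, [:: G (2 * k)])] p.2)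
    /\ z = \sum_(p <- s) p.1 * p.2.

Definition NPq_set (z : C) : Prop :=
  exists n p, Nq_set n /\ Pq_set p /\ z = n + p.

Definition eq_mod_NP (x y : C) : Prop := NPq_set (x - y).

End Rings.

(* Main.v *)
(* Let f(k) be the value of g_k and F the shuffle regularization of f with F(y) = 0.

   (i) F_q(-m; .) = psi F_q(m; .) turns the truncated symmetric sum into a nested sum over the
   chain 1 < ... < M-1 < -(M-1) < ... < -1, for which the harmonic product formula is exact.

   (ii) The q-shuffle product of words is classical up to terms carrying hbar; if one more letter a
   is appended at the end, these terms fall into n.  Hence, modulo N_q (an ideal for the stuffle
   product), F is a homomorphism for the classical shuffle product, and
   f(w y^n) = sum_j f(y^j) F(w y^(n-j)).  The shuffle relation for the symmetric values built
   from F then follows from the antipode of the shuffle algebra.  Replacing f by F in the symmetric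
   value of k changes it by terms c_n F F with n >= 1, where
   c_n = sum_(i+j=n) (-1)^i f(y^i) f(y^j) is the n-th elementary symmetric function of the chain
   above; by Newton's identities c_n is in the ideal generated by the f(2k). *)
From HB Require Import structures.
Require Import Defs.
From mathcomp Require Import all_boot all_order all_algebra.
From mathcomp Require Import boolp classical_sets functions reals topology normedtype sequences complex.
From mathcomp Require Import ring.
Import Order.TTheory GRing.Theory Num.Theory.
Import numFieldNormedType.Exports.
Local Open Scope ring_scope.
Set Implicit Arguments.
Unset Strict Implicit.
Unset Printing Implicit Defensive.

Local Notation cvg_to := Defs.cvg_to.

(** * Deconcatenation and shuffle *)

(** Formally, let Phi be the generating series of the values of [F] over all words, read in reversed
    order as everywhere below. If [F] is multiplicative for the shuffle product, Phi is group-like,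
    and the symmetric value built from [F] is a coefficient of Phi^-1 y Phi: a letter y adjoined to
    the word provides the middle factor, and reversal with a sign is the antipode, hence the
    inverse. This conjugate is a Lie element, and a Lie element takes the same value on y (a sh b)
    as on (-1)^|b| rev(b) y a, which is (ii). The series of [f] is Y(y) Phi with Y(y) the sum of the
    f(y^j) y^j, so [f] yields Phi^-1 Y(-y) y Y(y) Phi instead. The c_n are the coefficients of Y(-y)
    Y(y), and c_0 = 1 gives back the conjugate. These series are never formed: identities of the
    shuffle algebra are tested against an arbitrary function [g] on words. The obstacle is that [F]
    is multiplicative only modulo N_q, so every step has to be a congruence whose error is still in
    N_q after multiplication by further values. *)

Fixpoint splits (T : Type) (d : seq T) : seq (seq T * seq T) :=
  match d with
  | [::] => [:: ([::], [::])]
  | x :: d' => ([::], d) :: [seq (x :: p.1, p.2) | p <- splits d']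
  end.

Section Splits.
Variables (T : Type) (V : nmodType).
Implicit Types (G : seq T -> seq T -> V).

Lemma splits_nil G : \sum_(p <- splits [::]) G p.1 p.2 = G [::] [::].
Proof. by rewrite big_seq1. Qed.

Lemma splits_cons G x d :
  \sum_(p <- splits (x :: d)) G p.1 p.2 =
  G [::] (x :: d) + \sum_(p <- splits d) G (x :: p.1) p.2.
Proof. by rewrite /= big_cons big_map. Qed.

Lemma splits_coassoc (G : seq T -> seq T -> seq T -> V) d :
  \sum_(p <- splits d) \sum_(r <- splits p.1) G r.1 r.2 p.2 =
  \sum_(p <- splits d) \sum_(r <- splits p.2) G p.1 r.1 r.2.
Proof.
elim: d G => [|x d IH] G; first by rewrite /= !big_seq1.
rewrite (splits_cons (fun a b => \sum_(r <- splits a) G r.1 r.2 b)).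
rewrite (splits_cons (fun a b => \sum_(r <- splits b) G a r.1 r.2)).
rewrite (splits_nil (fun a b => G a b (x :: d))).
under eq_bigr do rewrite (splits_cons (fun a b => G a b _)).
rewrite big_split /= (IH (fun a b c => G (x :: a) b c)) addrA; congr (_ + _).
by rewrite (splits_cons (fun a b => G [::] a b)).
Qed.

Lemma splits_rcons G d x :
  \sum_(p <- splits (rcons d x)) G p.1 p.2 =
  \sum_(p <- splits d) G p.1 (rcons p.2 x) + G (rcons d x) [::].
Proof.
elim: d G => [|y d IH] G.
  by rewrite (splits_cons G) /= !big_seq1.
rewrite rcons_cons (splits_cons G) (IH (fun a => G (y :: a))).
by rewrite (splits_cons (fun a b => G a (rcons b x))) addrA.
Qed.

Lemma splits_rev G d :
  \sum_(p <- splits (rev d)) G p.1 p.2 =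
  \sum_(p <- splits d) G (rev p.2) (rev p.1).
Proof.
elim: d G => [|x d IH] G; first by rewrite /= !big_seq1.
rewrite rev_cons (splits_rcons G) (IH (fun a b => G a (rcons b x))).
rewrite (splits_cons (fun a b => G (rev b) (rev a))) rev_cons addrC.
by congr (_ + _); apply: eq_bigr => p _; rewrite rev_cons.
Qed.

Lemma splits_index G d :
  \sum_(p <- splits d) G p.1 p.2 =
  \sum_(i <- iota 0 (size d).+1) G (take i d) (drop i d).
Proof.
elim: d G => [|x d IH] G; first by rewrite /= !big_seq1.
rewrite (splits_cons G) -[iota 0 _]/(0%N :: iota 1 (size d).+1) big_cons.
by rewrite (IH (fun a => G (x :: a))) -[in RHS](addn0 1%N) iotaDl big_map.
Qed.

End Splits.

Lemma mem_splits (T : eqType) (d : seq T) p : p \in splits d -> p.1 ++ p.2 = d.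
Proof.
elim: d p => [|x d IH] p /=; first by rewrite inE => /eqP ->.
by rewrite inE => /predU1P[-> //|/mapP[r /IH hr ->]] /=; rewrite hr.
Qed.

Lemma xy_eqbP : Equality.axiom xy_eqb.
Proof. by do 2!case; constructor. Qed.
HB.instance Definition _ := hasDecEq.Build xy xy_eqbP.

Definition ally : pred (seq xy) := all (pred1 Ly).

Lemma ally_nseq p : ally p -> p = nseq (size p) Ly.
Proof. by move/all_pred1P. Qed.

Lemma nseq_ally n : ally (nseq n Ly).
Proof. by rewrite /ally all_nseq /= orbT. Qed.

Lemma rev_ally p : ally p -> rev p = p.
Proof. by move/ally_nseq->; rewrite rev_nseq. Qed.

(** Words are reversed, so these are the words of h^1; the default [Ly] lets the empty word in. *)
Definition wf (u : seq xy) : bool := last Ly u == Ly.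

Lemma wf_ally u : ally u -> wf u.
Proof.
by move/ally_nseq->; rewrite /wf; elim: (size u) => // n; rewrite -[n.+1]addn1 nseqD last_cat.
Qed.

Lemma shR_cons x u y v : shR (x :: u) (y :: v) =
  map (cons x) (shR u (y :: v)) ++ map (cons y) (shR (x :: u) v).
Proof. by []. Qed.

Lemma shR_ind (P : seq xy -> seq xy -> seq xy -> Prop) :
  (forall v, P [::] v v) -> (forall u, P u [::] u) ->
  (forall x u y v m, P u (y :: v) m -> P (x :: u) (y :: v) (x :: m)) ->
  (forall x u y v m, P (x :: u) v m -> P (x :: u) (y :: v) (y :: m)) ->
  forall u v m, m \in shR u v -> P u v m.
Proof.
move=> h1 h2 h3 h4; elim=> [|x u IHu] v; first by move=> m; rewrite inE => /eqP ->.
elim: v => [|y v IHv] m; first by rewrite inE => /eqP ->.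
by rewrite shR_cons mem_cat => /orP[] /mapP[m' hm ->]; [apply/h3/IHu|apply/h4/IHv].
Qed.

Lemma size_shR u v m : m \in shR u v -> size m = (size u + size v)%N.
Proof.
move: u v m; apply: shR_ind => [v|u|x u y v m /= ->|x u y v m /= ->] //.
  by rewrite addn0.
by rewrite addSnnS.
Qed.

Lemma ally_shR u v m : m \in shR u v -> ally m = ally u && ally v.
Proof.
move: u v m; apply: shR_ind => [v|u|x u y v m IH|x u y v m IH] //=.
- by rewrite andbT.
- by move: IH => /= ->; rewrite andbA.
- by move: IH => /= ->; rewrite andbCA.
Qed.

Lemma wf_suffix p s : wf (p ++ s) -> wf s.
Proof. by case: s => [//|x s]; rewrite /wf last_cat. Qed.

Lemma wf_shR u v m : m \in shR u v -> wf u -> wf v -> wf m.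
Proof.
rewrite /wf => hm; move: {1 3 5}Ly; move: u v m hm.
apply: shR_ind => [v d _ //|u d //|x u y v m IH d hu hv|x u y v m IH d hu hv].
  exact: IH.
exact: IH.
Qed.

(** The linear extension of [g] evaluated at u sh v; quantifying over [g] takes the place of a
    module of formal sums of words. *)
Definition shsum (V : nmodType) (g : seq xy -> V) (u v : seq xy) : V :=
  \sum_(m <- shR u v) g m.

Section Shuffle.
Variable V : nmodType.
Implicit Types (g : seq xy -> V).

Lemma eq_shsum g1 g2 u v : (forall m, m \in shR u v -> g1 m = g2 m) ->
  shsum g1 u v = shsum g2 u v.
Proof. by move=> h; apply: eq_big_seq. Qed.

Lemma shsum0l g v : shsum g [::] v = g v.
Proof. exact: big_seq1. Qed.

Lemma shsum0r g u : shsum g u [::] = g u.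
Proof. by case: u => [|x u]; exact: big_seq1. Qed.

Lemma shsum_cons g x u y v : shsum g (x :: u) (y :: v) =
  shsum (g \o cons x) u (y :: v) + shsum (g \o cons y) (x :: u) v.
Proof. by rewrite /shsum shR_cons big_cat !big_map. Qed.

Lemma shsumC g u v : shsum g u v = shsum g v u.
Proof.
elim: u g v => [|x u IHu] g; first by move=> v; rewrite shsum0l shsum0r.
move=> v; elim: v g => [|y v IHv] g; first by rewrite shsum0l shsum0r.
by rewrite !shsum_cons IHu IHv addrC.
Qed.

Lemma shsumD g1 g2 u v :
  shsum (fun m => g1 m + g2 m) u v = shsum g1 u v + shsum g2 u v.
Proof. exact: big_split. Qed.

Lemma shsumA g u v w :
  shsum (fun m => shsum g m w) u v = shsum (fun m => shsum g u m) v w.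
Proof.
elim: u g v w => [|x u IHu] g v w.
  by rewrite shsum0l; apply: eq_shsum => m _; rewrite shsum0l.
elim: v g w => [|y v IHv] g w; first by rewrite shsum0r shsum0l.
elim: w g => [|z w IHw] g.
  by rewrite shsum0r; apply: eq_shsum => m _; rewrite shsum0r.

pose gx := g \o cons x; pose gy := g \o cons y; pose gz := g \o cons z.
have -> : shsum (fun m => shsum g m (z :: w)) (x :: u) (y :: v) =
  shsum (fun m => shsum gx m (z :: w)) u (y :: v) +
  shsum (fun m => shsum gy m (z :: w)) (x :: u) v +
  shsum (fun m => shsum gz m w) (x :: u) (y :: v).
  rewrite !shsum_cons addrACA -!shsumD.
  by congr (_ + _); apply: eq_shsum => m _; rewrite /= shsum_cons.
have -> : shsum (fun m => shsum g (x :: u) m) (y :: v) (z :: w) =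
  shsum (fun m => shsum gx u m) (y :: v) (z :: w) +
  shsum (fun m => shsum gy (x :: u) m) v (z :: w) +
  shsum (fun m => shsum gz (x :: u) m) (y :: v) w.
  rewrite !shsum_cons -addrA addrACA -!shsumD.
  by congr (_ + _); apply: eq_shsum => m _; rewrite /= shsum_cons.
by rewrite IHu IHv IHw.
Qed.

Lemma shsum_rcons g u x v y : shsum g (rcons u x) (rcons v y) =
  shsum (fun m => g (rcons m x)) u (rcons v y) +
  shsum (fun m => g (rcons m y)) (rcons u x) v.
Proof.
elim: u g v => [|a u IHu] g v.
  elim: v g => [|b v IHv] g.
    by rewrite /= shsum_cons !shsum0l !shsum0r addrC.
  by rewrite /= !shsum_cons IHv !shsum0l addrCA !addrA.
elim: v g => [|b v IHv] g.
  have /= := IHu (g \o cons a) [::]; rewrite !shsum_cons !shsum0r => ->.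
  by rewrite addrAC.
rewrite !rcons_cons !shsum_cons -!rcons_cons IHv (IHu _ (b :: v)).
by rewrite addrACA.
Qed.

Lemma shsum_rev g u v : shsum g (rev u) (rev v) = shsum (g \o rev) u v.
Proof.
elim: u g v => [|x u IHu] g v; first by rewrite !shsum0l.
elim: v g => [|y v IHv] g; first by rewrite !shsum0r.
rewrite !rev_cons shsum_rcons -!rev_cons IHu IHv shsum_cons.
by congr (_ + _); apply: eq_shsum => m _; rewrite /= rev_cons.
Qed.

(** The bialgebra axiom: deconcatenation is multiplicative for the shuffle product. *)
Lemma shsum_splits (G : seq xy -> seq xy -> V) u v :
  shsum (fun m => \sum_(p <- splits m) G p.1 p.2) u v =
  \sum_(p <- splits u) \sum_(r <- splits v)
    shsum (fun a => shsum (G a) p.2 r.2) p.1 r.1.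
Proof.
elim: u G v => [|x u IHu] G v.
  by rewrite big_seq1 shsum0l; apply: eq_bigr => r _; rewrite !shsum0l.
elim: v G => [|y v IHv] G.
  by rewrite shsum0r; apply: eq_bigr => r _; rewrite big_seq1 !shsum0r.
pose Gc z := fun a => G (z :: a).
transitivity (shsum (G [::]) (x :: u) (y :: v) +
   (shsum (fun m => \sum_(p <- splits m) Gc x p.1 p.2) u (y :: v) +
    shsum (fun m => \sum_(p <- splits m) Gc y p.1 p.2) (x :: u) v)).
  rewrite !shsum_cons addrACA -!shsumD.
  by congr (_ + _); apply: eq_shsum => m _ /=; rewrite (splits_cons G).
rewrite IHu IHv.
rewrite (splits_cons (fun a b => \sum_(r <- splits (y :: v)) shsum (fun c => shsum (G c) b r.2) a r.1)).
rewrite (splits_cons (fun c d => shsum (fun c => shsum (G c) (x :: u) d) [::] c)).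
rewrite !shsum0l -addrA; congr (_ + _).
rewrite (splits_cons (fun a b => \sum_(r <- splits v) shsum (fun c => shsum (Gc y c) b r.2) a r.1)).
rewrite addrCA; congr (_ + _).
  by apply: eq_bigr => r _; rewrite !shsum0l.
rewrite -big_split; apply: eq_bigr => p _ /=.
rewrite (splits_cons (fun c d => shsum (fun a => shsum (G a) p.2 d) (x :: p.1) c)).
rewrite (splits_cons (fun c d => shsum (fun a => shsum (Gc x a) p.2 d) p.1 c)).
rewrite !shsum0r -addrA; congr (_ + _).
by rewrite -big_split; apply: eq_bigr => r _; rewrite shsum_cons.
Qed.

End Shuffle.

(** * The antipode of the shuffle algebra *)

Section Antipode.
Variable V : zmodType.
Implicit Types (g : seq xy -> V).

Lemma shsumN g u v : shsum (fun m => - g m) u v = - shsum g u v.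
Proof. exact: sumrN. Qed.

Lemma shsum_sum (I : Type) (r : seq I) (g : I -> seq xy -> V) u v :
  shsum (fun m => \sum_(i <- r) g i m) u v = \sum_(i <- r) shsum (g i) u v.
Proof. exact: exchange_big. Qed.

(** Multiplication by (-1)^n in a bare [zmodType], used both for numbers and for sequences. *)
Definition sgn (n : nat) (z : V) : V := if odd n then - z else z.

Lemma sgnD n m z : sgn (n + m) z = sgn n (sgn m z).
Proof. by rewrite /sgn oddD; do 2!case: odd => //=; rewrite opprK. Qed.

Lemma sgnS n z : sgn n.+1 z = - sgn n z.
Proof. by rewrite /sgn /=; case: odd; rewrite ?opprK. Qed.

Lemma sgnB n a b : sgn n (a - b) = sgn n a - sgn n b.
Proof. by rewrite /sgn; case: odd; rewrite ?opprD. Qed.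

Lemma sgn_sum (I : Type) (r : seq I) (P : pred I) (F : I -> V) n :
  sgn n (\sum_(i <- r | P i) F i) = \sum_(i <- r | P i) sgn n (F i).
Proof. by rewrite /sgn; case: odd; rewrite ?sumrN. Qed.

Lemma sgn_shsum g n u v : shsum (fun m => sgn n (g m)) u v = sgn n (shsum g u v).
Proof. by rewrite /shsum sgn_sum. Qed.

(* [r] is the reversal of the letters already passed; the sum telescopes. *)
Lemma shsum_zip g r d :
  \sum_(p <- splits d) sgn (size p.1) (shsum g (rev p.1 ++ r) p.2) =
  match r, d with
  | x :: r', _ => shsum (g \o cons x) r' d
  | [::], [::] => g [::]
  | [::], _ => 0
  end.
Proof.
elim: d r => [|y d IH] r.
  by rewrite big_seq1 shsum0r /sgn; case: r => [//|x r] /=; rewrite shsum0r.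
rewrite (splits_cons (fun a b => sgn (size a) (shsum g (rev a ++ r) b))).
under eq_bigr => p _ do rewrite rev_cons cat_rcons /= sgnS.
rewrite sumrN IH /sgn /=; case: r => [|x r]; first by rewrite !shsum0l subrr.
by rewrite shsum_cons addrK.
Qed.

(** Reversal with a sign is the antipode. This is [shsum_zip] with no letter passed yet, applied to
    the reversed word. *)
Lemma antipode g d : d != [::] ->
  \sum_(p <- splits d) sgn (size p.2) (shsum g p.1 (rev p.2)) = 0.
Proof.
move=> hd; rewrite -[d]revK (splits_rev (fun a b => sgn (size b) (shsum g a (rev b)))).
have := shsum_zip (g \o rev) [::] (rev d).
have -> : (match rev d with [::] => (g \o rev) [::] | _ => 0 end) = 0.
  by move: hd; case/lastP: d => // d x _; rewrite rev_rcons.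
move=> h0; rewrite -[RHS]h0; apply: eq_bigr => p _; rewrite size_rev cats0.
by rewrite -[in RHS]shsum_rev !revK [in LHS]shsumC.
Qed.

(** By induction on b, according to the first letter of the shuffles. If it comes from [p.1], it is
    the first letter of b and the induction hypothesis applies; if it is the distinguished y, what
    follows is p.1 sh a sh rev(p.2), and these sum to zero by [antipode]. *)
Lemma antipode_conj g a b :
  \sum_(p <- splits b) sgn (size p.2)
    (shsum (fun r => shsum g p.1 (Ly :: r)) a (rev p.2)) = g (b ++ Ly :: a).
Proof.
elim: b g => [|x b IH] g; first by rewrite big_seq1 shsum0r shsum0l /sgn.
rewrite (splits_cons (fun c d => sgn (size d)
  (shsum (fun r => shsum g c (Ly :: r)) a (rev d)))).
transitivity (\sum_(p <- splits b) sgn (size p.2)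
    (shsum (fun r => shsum (g \o cons x) p.1 (Ly :: r)) a (rev p.2)) +
  \sum_(p <- splits (x :: b)) sgn (size p.2)
    (shsum (fun r => shsum (g \o cons Ly) p.1 r) a (rev p.2))).
  rewrite (splits_cons (fun c d => sgn (size d)
    (shsum (fun r => shsum (g \o cons Ly) c r) a (rev d)))) addrCA.
  congr (_ + _).
    by congr sgn; apply: eq_shsum => m _; rewrite !shsum0l.
  rewrite -big_split; apply: eq_bigr => p _ /=.
  rewrite -[in RHS]sgn_shsum -[in X in _ = _ + X]sgn_shsum -shsumD -sgn_shsum.
  apply: eq_shsum => m _; rewrite shsum_cons.
  by rewrite /sgn; case: odd; rewrite ?opprD.
rewrite IH -[RHS]addr0; congr (_ + _).
have h0 := antipode (shsum (g \o cons Ly) a) (isT : x :: b != [::]); rewrite -[RHS]h0.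
by apply: eq_bigr => p _; rewrite -[in RHS]shsumA [in RHS]shsumC shsumA.
Qed.

End Antipode.

(** * Regularization *)

Lemma yx_decomp u : (exists n, u = nseq n Ly) \/ (exists n v, u = nseq n Ly ++ Lx :: v).
Proof.
elim: u => [|[] u [[n IH]|[n [v IH]]]]; first by left; exists 0%N.
- by right; exists 0%N, u.
- by right; exists 0%N, u.
- by left; exists n.+1; rewrite IH.
- by right; exists n.+1, v; rewrite IH.
Qed.

Lemma ally_cat_cons p r : ally p -> p ++ Ly :: r = Ly :: p ++ r.
Proof. by elim: p => //= x p IH /andP[/eqP -> /IH ->]. Qed.

Section Reg.
Variable V : zmodType.
Implicit Types (g : seq xy -> V).

(* Shuffle regularization: the shuffle homomorphism that is the identity on words ending in x
   and kills y (words are read from right to left). *)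
Definition reg g (u : seq xy) : V :=
  \sum_(p <- splits u) if ally p.1 then sgn (size p.1) (shsum g p.2 p.1) else 0.

Lemma sum_splits_if0 x (G : seq xy -> seq xy -> V) d : x != Ly ->
  \sum_(p <- splits (x :: d)) (if ally p.1 then G p.1 p.2 else 0) = G [::] (x :: d).
Proof.
move=> hx; rewrite (splits_cons (fun a b => if ally a then G a b else 0)) /=.
by rewrite (negbTE hx) big1 ?addr0.
Qed.

(** Split each shuffle by its first letter. The part that begins with y cancels between consecutive
    cuts, which leaves a boundary term at each end. The parameter j absorbs the y that the induction
    moves from the word to the other factor. *)
Lemma reg_yx_aux g n v j :
  \sum_(p <- splits (nseq n Ly ++ Lx :: v))
     (if ally p.1 then sgn (size p.1) (shsum g p.2 (p.1 ++ nseq j Ly)) else 0) =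
  (if j is j'.+1 then shsum (g \o cons Ly) (nseq n Ly ++ Lx :: v) (nseq j' Ly) else 0) +
  sgn n (shsum (g \o cons Lx) v (nseq (n + j) Ly)).
Proof.
elim: n j => [|n IH] j.
  rewrite (sum_splits_if0 (fun a b => sgn (size a) (shsum g b (a ++ nseq j Ly)))) //.
  rewrite /sgn /=; case: j => [|j]; first by rewrite !shsum0r add0r.
  by rewrite shsum_cons addrC.
rewrite (splits_cons (fun a b => if ally a then sgn (size a) (shsum g b (a ++ nseq j Ly)) else 0)).
rewrite -/(cat _ _) -/(nseq _ _) /=.
rewrite (eq_bigr (fun p => - if ally p.1 then sgn (size p.1) (shsum g p.2 (p.1 ++ nseq j.+1 Ly)) else 0)).
  rewrite sumrN IH sgnS addnS opprD addrA; congr (_ + _).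
  rewrite {1}/sgn /=; case: j => [|j]; first by rewrite !shsum0r /= subrr.
  by rewrite shsum_cons addrAC subrr add0r.
move=> p _; case: ifP => h; rewrite ?oppr0 // sgnS.
by rewrite -(ally_cat_cons _ h).
Qed.

(** With j = 0 one boundary term remains, and all its words begin with x. Hence regularized values
    only involve admissible indices. *)
Lemma reg_yx g n v : reg g (nseq n Ly ++ Lx :: v) =
  sgn n (shsum (g \o cons Lx) v (nseq n Ly)).
Proof.
have := reg_yx_aux g n v 0; rewrite addn0 add0r => <-.
by apply: eq_bigr => p _; rewrite cats0.
Qed.

(** A power of y is its own reversal, so the defining sum is the antipode relation. *)
Lemma reg_ally g u : ally u -> u != [::] -> reg g u = 0.
Proof.
move=> hu hn; have h0 := antipode g hn.
rewrite -[RHS]h0 /reg -{1}(rev_ally hu).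
rewrite (splits_rev (fun a b => if ally a then sgn (size a) (shsum g b a) else 0)).
apply: eq_big_seq => p /mem_splits hp; move: hu; rewrite -hp /ally all_cat => /andP[h1 h2].
by rewrite (rev_ally h1) (rev_ally h2) h2.
Qed.

Lemma reg_nil g : reg g [::] = g [::].
Proof. by rewrite /reg big_seq1 shsum0l. Qed.

Lemma shsum_exchange4 g u1 u2 v1 v2 :
  shsum (fun a => shsum (fun s => shsum g s a) u2 v2) u1 v1 =
  shsum (fun a => shsum (fun b => shsum g a b) v2 v1) u2 u1.
Proof.
pose k := shsum g u2.
transitivity (shsum (fun a => shsum k v2 a) u1 v1).
  by apply: eq_shsum => a _; rewrite shsumA.
rewrite -shsumA shsumC shsumA.
transitivity (shsum (fun b => shsum (fun a => shsum g a b) u2 u1) v2 v1).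
  by apply: eq_shsum => b _; rewrite shsumA.
exact: exchange_big.
Qed.

(** [reg] is the convolution of the identity with the signed projection to the powers of y. Both are
    multiplicative for the commutative shuffle product, and deconcatenation is too, by
    [shsum_splits]. *)
Lemma reg_shsum g u v :
  shsum (reg g) u v = reg (fun a => reg (fun b => shsum g a b) v) u.
Proof.
rewrite /reg (shsum_splits (fun a b => if ally a then sgn (size a) (shsum g b a) else 0)).
apply: eq_bigr => p _; rewrite shsum_sum sgn_sum.
case hp: (ally p.1); last first.
  rewrite big1 // => r _; rewrite /shsum big1_seq // => a /andP[_ ha].
  by rewrite (ally_shR ha) hp /= big1.
apply: eq_bigr => r _; case hr: (ally r.1); last first.
  rewrite {2}/shsum [X in _ = sgn _ X]big1 // ?/sgn ?oppr0 ?if_same //.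
  rewrite /shsum big1_seq // => a /andP[_ ha].
  by rewrite (ally_shR ha) hp hr /= big1.
rewrite sgn_shsum -sgnD -shsum_exchange4 -sgn_shsum.
apply: eq_shsum => a ha; rewrite (ally_shR ha) hp hr /= (size_shR ha).
by rewrite sgn_shsum.
Qed.

End Reg.

Section SplitsMore.
Variables (T : Type) (V : nmodType).
Implicit Types (G : seq T -> seq T -> V).

Lemma splits_cat_cons G d y a :
  \sum_(p <- splits (d ++ y :: a)) G p.1 p.2 =
  \sum_(p <- splits d) G p.1 (p.2 ++ y :: a) +
  \sum_(p <- splits a) G (d ++ y :: p.1) p.2.
Proof.
elim: d G => [|x d IH] G; first by rewrite big_seq1 (splits_cons G).
rewrite (splits_cons G) (IH (fun a => G (x :: a))).
by rewrite (splits_cons (fun b c => G b (c ++ y :: a))) addrA.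
Qed.

Lemma splits_shift G d : \sum_(p <- splits d) G p.1 p.2 =
  G [::] d + \sum_(p <- splits d) if p.2 is z :: v then G (rcons p.1 z) v else 0.
Proof.
elim: d G => [|x d IH] G; first by rewrite !big_seq1 addr0.
rewrite (splits_cons G) (IH (fun a => G (x :: a))); congr (_ + _).
by rewrite (splits_cons (fun a b => if b is z :: v then G (rcons a z) v else 0)).
Qed.
End SplitsMore.

Definition atY (V : nmodType) (h : seq xy -> V) (s : seq xy) : V :=
  if s is Ly :: u then h u else 0.

(** Deleting a leading y, with value 0 when there is none, is a derivation of the shuffle
    product. *)
Lemma shsum_atY (V : nmodType) (h : seq xy -> V) u v :
  shsum (atY h) u v =
  atY (fun u' => shsum h u' v) u + atY (fun v' => shsum h u v') v.
Proof.
case: u => [|x u]; first by rewrite shsum0l add0r; case: v => [//|[] v] //=; rewrite shsum0l.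
case: v => [|y v]; first by rewrite shsum0r addr0; case: x => //=; rewrite shsum0r.
have h0 a b : shsum (fun=> 0 : V) a b = 0 by apply: big1.
by rewrite shsum_cons; case: x; case: y => /=; rewrite /comp /= ?h0.
Qed.

(** * Symmetric sums modulo an ideal *)

Section Symmetric.
Variable K : comNzRingType.
Implicit Types (f : seq xy -> K) (u v z : seq xy).

Lemma sgn_mull n (a b : K) : sgn n a * b = sgn n (a * b).
Proof. by rewrite /sgn; case: odd; rewrite ?mulNr. Qed.

Lemma sgn_mulr n (a b : K) : a * sgn n b = sgn n (a * b).
Proof. by rewrite /sgn; case: odd; rewrite ?mulrN. Qed.

(* The sum over the occurrences [z = v ++ y :: u] of the letter y; with [z] the reversal of
   the word z_k y, this is the symmetric value of the index k. *)
Definition symsum f z : K :=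
  \sum_(p <- splits z) atY (fun u => sgn (size p.1) (f u * f (rev p.1))) p.2.

(** At z = y^(n+1) this is the number c_n. *)
Definition ysum f z : K :=
  \sum_(p <- splits z) atY (fun u => sgn (size p.1) (f p.1 * f u)) p.2.

Variable N : K -> Prop.
Hypothesis N0 : N 0.
Hypothesis ND : forall a b, N a -> N b -> N (a + b).
Hypothesis NN : forall a, N a -> N (- a).

Definition eqN (a b : K) : Prop := N (a - b).

Lemma eqNxx a : eqN a a. Proof. by rewrite /eqN subrr. Qed.
Lemma eqN_eq a b : a = b -> eqN a b. Proof. by move=> ->; exact: eqNxx. Qed.
Lemma eqN_sym a b : eqN a b -> eqN b a.
Proof. by move=> h; rewrite /eqN -opprB; exact: NN. Qed.
Lemma eqN_trans b a c : eqN a b -> eqN b c -> eqN a c.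
Proof. by move=> h1 h2; rewrite /eqN -(subrK b a) -addrA; exact: ND. Qed.
Lemma eqND a b c d : eqN a b -> eqN c d -> eqN (a + c) (b + d).
Proof. by move=> h1 h2; rewrite /eqN opprD addrACA; exact: ND. Qed.
Lemma eqN_sum (I : eqType) (r : seq I) (F G : I -> K) :
  (forall i, i \in r -> eqN (F i) (G i)) -> eqN (\sum_(i <- r) F i) (\sum_(i <- r) G i).
Proof.
elim: r => [|i r IH] h; first by rewrite !big_nil; exact: eqNxx.
rewrite !big_cons; apply: eqND; first by apply: h; rewrite mem_head.
by apply: IH => j hj; apply: h; rewrite inE hj orbT.
Qed.
Lemma Nsgn n a : N a -> N (sgn n a).
Proof. by rewrite /sgn; case: odd => // ?; exact: NN. Qed.
Lemma eqN_sgn n a b : eqN a b -> eqN (sgn n a) (sgn n b).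
Proof. by rewrite /eqN -sgnB; exact: Nsgn. Qed.
Lemma eqNN a b : eqN a b -> eqN (- a) (- b).
Proof. by move=> h; rewrite /eqN -opprD; exact: NN. Qed.
Lemma Nsum (I : eqType) (r : seq I) (F : I -> K) :
  (forall i, i \in r -> N (F i)) -> N (\sum_(i <- r) F i).
Proof.
elim: r => [|i r IH] h; first by rewrite big_nil.
rewrite big_cons; apply: ND; first by apply: h; rewrite mem_head.
by apply: IH => j hj; apply: h; rewrite inE hj orbT.
Qed.

Lemma eqN_atY (h k : seq xy -> K) s :
  (forall u, s = Ly :: u -> eqN (h u) (k u)) -> eqN (atY h s) (atY k s).
Proof. by case: s => [|[] s] H /=; [exact: eqNxx|exact: eqNxx|exact: H]. Qed.

(** Abstract form of the values modulo N_q. Multiplicativity is assumed for words with leading x;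
    [f_reg] reduces all other words to these. *)
Variable f : seq xy -> K.
Hypothesis f_nil : f [::] = 1.
Hypothesis N_mulf : forall u (z : K), wf u -> N z -> N (z * f u).
Hypothesis f_shuffle : forall a b, wf (Lx :: a) -> wf (Lx :: b) ->
  eqN (f (Lx :: a) * f (Lx :: b)) (shsum f (Lx :: a) (Lx :: b)).
Local Notation F := (reg f).
Hypothesis f_reg : forall u, wf u ->
  eqN (f u) (\sum_(p <- splits u) if ally p.1 then f p.1 * F p.2 else 0).

Lemma mulF_closed (P : K -> Prop) u (z : K) :
  (forall a b, P a -> P b -> P (a + b)) -> (forall a, P a -> P (- a)) -> P 0 ->
  (forall m, wf m -> P (z * f m)) -> wf u -> P (z * F u).
Proof.
move=> PD PN P0 hP hu; rewrite /reg mulr_sumr.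
rewrite big_seq; elim/big_ind: _ => // p /mem_splits hp.
case: ifP => hy; last by rewrite mulr0.
rewrite sgn_mulr; suff: P (z * shsum f p.2 p.1).
  by rewrite /sgn; case: odd => // /PN.
rewrite /shsum mulr_sumr big_seq; elim/big_ind: _ => // m hm; apply: hP.
by apply: (wf_shR hm); [apply: (@wf_suffix p.1); rewrite hp|exact: wf_ally].
Qed.

Lemma N_mulF u (z : K) : wf u -> N z -> N (z * F u).
Proof. by move=> hu hz; apply: mulF_closed => // m hm; exact: N_mulf. Qed.

Lemma eqN_mulF u a b : wf u -> eqN a b -> eqN (a * F u) (b * F u).
Proof. by move=> hu h; rewrite /eqN -mulrBl; exact: N_mulF. Qed.

(** By [reg_yx] both factors are signed sums of values of [f] at words with leading x, where
    [f_shuffle] applies; [reg_shsum] brings the right-hand side to the same form. A nonempty power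
    of y makes both sides vanish. *)
Lemma F_shuffle u v : wf u -> wf v -> eqN (F u * F v) (shsum F u v).
Proof.
move=> hu hv; rewrite reg_shsum.
case: (yx_decomp u) => [[n ->]|[n [u0 hu0]]].
  case: n => [|n]; last by rewrite !(reg_ally _ (nseq_ally n.+1)) // mul0r; exact: eqNxx.
  rewrite !reg_nil f_nil mul1r /reg; apply: eqN_sum => p _.
  case: ifP => _; last exact: eqNxx.
  by apply: eqN_sgn; apply: eqN_sum => m _; rewrite shsum0l; exact: eqNxx.
case: (yx_decomp v) => [[m ->]|[m [v0 hv0]]].
  case: m => [|m].
    rewrite !reg_nil f_nil mulr1 /reg; apply: eqN_sum => p _.
    case: ifP => _; last exact: eqNxx.
    by apply: eqN_sgn; apply: eqN_sum => w _; rewrite big_seq1 /= shsum0l shsum0r; exact: eqNxx.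
  rewrite (reg_ally _ (nseq_ally m.+1)) // mulr0 /reg big1 => [|p _]; first exact: eqNxx.
  case: ifP => // _; rewrite /shsum big1 ?/sgn ?oppr0 ?if_same // => w _.
  exact: (reg_ally _ (nseq_ally m.+1)).
have hx k w0 w : wf w -> w = nseq k Ly ++ Lx :: w0 ->
    forall m, m \in shR w0 (nseq k Ly) -> wf (Lx :: m).
  move=> hw e w' hm; have : wf (Lx :: w0) by apply: (@wf_suffix (nseq k Ly)); rewrite -e.
  have := wf_ally (nseq_ally k); move: hm; case: w0 e => [|y w0] e //.
  move=> hm hk hl; have: wf w' by apply: (wf_shR hm).
  by have := size_shR hm; case: w' {hm} => // _; rewrite addSn.
rewrite hu0 hv0 !reg_yx sgn_mull; apply: eqN_sgn.
rewrite /shsum mulr_suml; apply: eqN_sum => a ha /=.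
rewrite reg_yx sgn_mulr; apply: eqN_sgn.
rewrite /shsum mulr_sumr; apply: eqN_sum => b hb /=.
by apply: f_shuffle; [exact: (hx _ _ _ hu hu0)|exact: (hx _ _ _ hv hv0)].
Qed.

(** Contribution of a marked y that comes from one of the two factors. Multiplicativity of [F]
    detaches the part [r.2] of b from u and joins it to the reversed factor; the sum over the cuts
    of b is then [antipode_conj]. *)
Lemma symsum_shuffle_half p1 u b : wf u -> wf b ->
  eqN (\sum_(r <- splits b) shsum (fun c => - sgn (size c) (shsum F u r.2 * F (rev (Ly :: c)))) p1 r.1)
      (- sgn (size p1) (F u * F (rev (Ly :: p1) ++ b))).
Proof.
move=> hu hb.
have hwf c : wf (rev (Ly :: c)) by rewrite /wf rev_cons last_rcons.
pose g := fun w => F (rev w).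
apply: (@eqN_trans (\sum_(r <- splits b) - sgn (size p1) (F u *
   sgn (size r.1) (shsum (fun c => shsum g (rev r.2) (Ly :: c)) p1 r.1)))).
  apply: eqN_sum => r /mem_splits hr.
  have hr2 : wf r.2 by apply: (@wf_suffix r.1); rewrite hr.
  rewrite sgn_mulr -sgnD /shsum mulr_sumr sgn_sum -sumrN; apply: eqN_sum => c hc.
  rewrite -(size_shR hc); apply: eqNN; apply: eqN_sgn.
  apply: (@eqN_trans (F u * F r.2 * F (rev (Ly :: c)))).
    by apply: eqN_mulF => //; apply: eqN_sym; exact: F_shuffle.
  rewrite -mulrA mulrC [in X in eqN _ X]mulrC; apply: eqN_mulF => //.
  rewrite -[Ly :: c]revK -[\sum_(m <- _) _]/(shsum _ _ _) shsum_rev.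
  rewrite (eq_shsum (g2 := F)) ?revK; last by move=> m _; rewrite /g /= revK.
  exact: F_shuffle.
rewrite sumrN -sgn_sum -mulr_sumr; apply: eqNN; apply: eqN_sgn.
have := antipode_conj g p1 (rev b).
rewrite (splits_rev (fun c d => sgn (size d) (shsum (fun r => shsum g c (Ly :: r)) p1 (rev d)))).
rewrite {2}/g rev_cat revK => <-.
apply: eqN_eq; congr (_ * _).
by apply: eq_bigr => r _; rewrite size_rev revK.
Qed.

Lemma symsum_cons z : symsum F (Ly :: z) = F z +
  \sum_(p <- splits z) atY (fun u => - sgn (size p.1) (F u * F (rev (Ly :: p.1)))) p.2.
Proof.
rewrite /symsum (splits_cons (fun a s => atY (fun u => sgn (size a) (F u * F (rev a))) s)).
rewrite /= {1}/sgn /= reg_nil f_nil mulr1; congr (_ + _).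
by apply: eq_bigr => p _; case: p.2 => [//|[] s] //=; rewrite sgnS.
Qed.

(** On both sides the marked y is the adjoined one, a letter of a, or a letter of b. These cases
    contribute F(a) F(b), [H a b] and [H b a]. *)
Lemma symsum_shuffle a b : wf a -> wf b ->
  eqN (shsum (fun m => symsum F (Ly :: m)) a b) (sgn (size b) (symsum F (rev b ++ Ly :: a))).
Proof.
move=> ha hb.
pose G c s := atY (fun u => - sgn (size c) (F u * F (rev (Ly :: c)))) s.
pose H u d := \sum_(p <- splits u) atY (fun w => - sgn (size p.1) (F w * F (rev (Ly :: p.1) ++ d))) p.2.
apply: (@eqN_trans (F a * F b + (H a b + H b a))).
  rewrite (eq_shsum (fun m _ => symsum_cons m)) shsumD; apply: eqND.
    by apply: eqN_sym; exact: F_shuffle.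
  rewrite (shsum_splits G).
  pose A a b := \sum_(p <- splits a) \sum_(r <- splits b)
      shsum (fun c => atY (fun u => shsum (fun w => - sgn (size c) (F w * F (rev (Ly :: c)))) u r.2) p.2) p.1 r.1.
  rewrite (_ : \sum_(p <- splits a) _ = A a b + A b a); last first.
    rewrite /A [X in _ = _ + X]exchange_big -big_split; apply: eq_bigr => p _.
    rewrite -big_split; apply: eq_bigr => r _ /=.
    rewrite [X in _ = _ + X]shsumC -shsumD; apply: eq_shsum => c _.
    rewrite shsum_atY; congr (_ + _).
    by case: r.2 => [//|[] s] //=; rewrite shsumC.
  have hA u d : wf u -> wf d -> eqN (A u d) (H u d).
    move=> hu hd; apply: eqN_sum => p /mem_splits hp.
    case e: p.2 => [|[] s] /=.
    - by rewrite big1 => [|r _]; [exact: eqNxx|apply: big1].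
    - by rewrite big1 => [|r _]; [exact: eqNxx|apply: big1].
    apply: eqN_trans (symsum_shuffle_half p.1 _ hd); last first.
      by apply: (@wf_suffix (rcons p.1 Ly)); rewrite cat_rcons -e hp.
    apply: eqN_sum => r _; apply: eqN_sum => c _.
    by apply: eqN_eq; rewrite shsumN sgn_shsum /shsum mulr_suml.
  by apply: eqND; exact: hA.
rewrite /symsum; pose T v s := atY (fun u => sgn (size v) (F u * F (rev v))) s.
rewrite (splits_cat_cons T) (splits_rev (fun c d => T c (d ++ Ly :: a))).
rewrite (splits_shift (fun c d => T (rev d) (rev c ++ Ly :: a))).
have sgnK n (x : K) : sgn n (sgn n x) = x by rewrite /sgn; case: odd; rewrite ?opprK.
have sgn_add n (x y : K) : sgn n (x + y) = sgn n x + sgn n y.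
  by rewrite /sgn; case: odd; rewrite ?opprD.
rewrite !sgn_add /T /= size_rev revK sgnK -addrA [H a b + _]addrC.
rewrite (_ : H b a = sgn (size b) (\sum_(p <- splits b) if p.2 is z :: v then
   atY (fun u => sgn (size (rev v)) (F u * F (rev (rev v)))) (rev (rcons p.1 z) ++ Ly :: a) else 0)).
  rewrite (_ : H a b = sgn (size b) (\sum_(p <- splits a) atY (fun u =>
     sgn (size (rev b ++ Ly :: p.1)) (F u * F (rev (rev b ++ Ly :: p.1)))) p.2)); first exact: eqNxx.
  rewrite sgn_sum; apply: eq_bigr => p _; case: p.2 => [|[] s] /=.
  - by rewrite /sgn oppr0 if_same.
  - by rewrite /sgn oppr0 if_same.
  by rewrite size_cat size_rev sgnD sgnK sgnS rev_cat revK.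
rewrite sgn_sum; apply: eq_big_seq => p /mem_splits hp.
case e: p.2 => [|[] s] /=; rewrite ?rev_rcons /=.
- by rewrite /sgn oppr0 if_same.
- by rewrite /sgn oppr0 if_same.
rewrite -hp e size_cat /= size_rev revK -cat_rcons -rev_cons.
by rewrite addnS sgnS sgnD sgnK [F s * _]mulrC.
Qed.

Variable NP : K -> Prop.
Hypothesis NP_N : forall z : K, N z -> NP z.
Hypothesis NPD : forall a b, NP a -> NP b -> NP (a + b).
Hypothesis NPN : forall a, NP a -> NP (- a).
Hypothesis NP_ysum : forall n u v, wf u -> wf v -> NP (ysum f (nseq n.+2 Ly) * (F u * F v)).

Lemma N_mulsumf u (z : K) : wf u -> N z ->
  N (z * (\sum_(p <- splits u) if ally p.1 then f p.1 * F p.2 else 0)).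
Proof.
move=> hu hz; rewrite mulr_sumr; apply: Nsum => p /mem_splits hp.
case: ifP => h; last by rewrite mulr0.
rewrite mulrA; apply: N_mulF; first by apply: (@wf_suffix p.1); rewrite hp.
by apply: N_mulf => //; exact: wf_ally.
Qed.

(** Apply [f_reg] on both sides of the marked y. This cuts the word into a prefix, y^i, the marked
    y, y^j and a suffix; coassociativity regroups the three middle pieces into one run of y, and the
    sum over the marked position in the run is [ysum]. *)
Lemma symsum_expand w : wf w ->
  eqN (symsum f (Ly :: w)) (\sum_(p <- splits (Ly :: w)) sgn (size p.1) (F (rev p.1) *
     \sum_(t <- splits p.2) if ally t.1 then ysum f t.1 * F t.2 else 0)).
Proof.
move=> hw; pose E u := \sum_(s <- splits u) if ally s.1 then f s.1 * F s.2 else 0.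
apply: (@eqN_trans (symsum E (Ly :: w))).
  apply: eqN_sum => p /mem_splits hp; apply: eqN_atY => u hu; apply: eqN_sgn.
  have wu : wf u.
    by apply: (@wf_suffix (rcons p.1 Ly)); rewrite cat_rcons -hu hp.
  have wp : wf (rev p.1).
    by case: p.1 hp => [//|y s] /= [-> _]; rewrite /wf rev_cons last_rcons.
  apply: (@eqN_trans (E u * f (rev p.1))).
    by rewrite /eqN -mulrBl; apply: N_mulf => //; exact: f_reg.
  rewrite /eqN -mulrBr mulrC; apply: N_mulsumf => //; exact: f_reg.
rewrite /symsum.
pose W v q s := if ally q then sgn (size v) (F (rev v) * (sgn (size q) (f q *
   atY (fun u => E u) s))) else 0.
rewrite (_ : \sum_(p <- _) _ = \sum_(p <- splits (Ly :: w)) \sum_(r <- splits p.2) W p.1 r.1 r.2).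
  rewrite (_ : \sum_(p <- splits (Ly :: w)) \sum_(r <- _) _ =
     \sum_(p <- splits (Ly :: w)) sgn (size p.1) (F (rev p.1) *
     \sum_(t <- splits p.2) if ally t.1 then ysum f t.1 * F t.2 else 0)).
    exact: eqNxx.
  apply: eq_bigr => p _; rewrite /W mulr_sumr sgn_sum.
  pose X a b c := sgn (size p.1) (F (rev p.1) * (if ally a then
    sgn (size a) (f a * atY (fun b' => if ally b' then f b' * F c else 0) b) else 0)).
  transitivity (\sum_(t <- splits p.2) \sum_(r <- splits t.2) X t.1 r.1 r.2).
    apply: eq_bigr => t _; rewrite /X; case: ifP => _; last first.
      by rewrite big1 // => r _; rewrite mulr0 /sgn oppr0 if_same.
    rewrite -sgn_sum -mulr_sumr -sgn_sum -mulr_sumr.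
    congr (sgn _ (_ * sgn _ (_ * _))).
    case: t.2 => [|[] u] /=; rewrite ?big_seq1 //.
      by rewrite big_cons big_map big1 //= addr0.
    by rewrite big_cons big_map /= add0r.
  rewrite -splits_coassoc; apply: eq_bigr => t _; rewrite -sgn_sum -mulr_sumr.
  congr (sgn _ (_ * _)); rewrite /ysum; case: ifP => h.
    rewrite mulr_suml; apply: eq_big_seq => r /mem_splits hr.
    move: h; rewrite -hr /ally all_cat -!/(ally _) => /andP[-> h2].
    case: r.2 h2 => [|[] s] //=; rewrite ?mulr0 ?mul0r ?/sgn ?oppr0 ?if_same //.
    rewrite -/(ally s) => ->.
    by rewrite -!/(sgn _ _) sgn_mull mulrA.
  rewrite big1_seq // => r /andP[_ /mem_splits hr].
  case: ifP => h1 //; move: h; rewrite -hr /ally all_cat -!/(ally _) h1 /=.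
  case: r.2 => [|[] s] //=; rewrite ?mulr0 /sgn ?oppr0 ?if_same //.
  by rewrite -/(ally s) => ->; rewrite !(mulr0, oppr0, if_same).
rewrite -splits_coassoc; apply: eq_bigr => p _.
case: p.2 => [|[] s] /=.
- by rewrite big1 // => r _; rewrite /W /=; case: ifP; rewrite // !mulr0 /sgn !oppr0 !if_same mulr0 oppr0 if_same.
- by rewrite big1 // => r _; rewrite /W /=; case: ifP; rewrite // !mulr0 /sgn !oppr0 !if_same mulr0 oppr0 if_same.
rewrite {2}/E (splits_rev (fun a b => if ally a then f a * F b else 0)).
rewrite mulr_sumr sgn_sum; apply: eq_big_seq => r /mem_splits hr.
rewrite /W /= {1}/ally all_rev -/(ally _); case: ifP => h; last first.
  by rewrite mulr0 /sgn oppr0 if_same.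
rewrite (rev_ally h) -hr size_cat sgnD; congr sgn; rewrite sgn_mulr; congr sgn.
by ring.
Qed.

(** In the expansion, an empty run has [ysum] 0 and a run of one y has [ysum] 1, which restores the
    symmetric value of [F]. Longer runs lie in [NP] by [NP_ysum]. *)
Lemma symsum_reg w : wf w -> NP (symsum f (Ly :: w) - symsum F (Ly :: w)).
Proof.
move=> hw.
have NP0 : NP 0 by exact: NP_N.
rewrite -(subrKA (\sum_(p <- splits (Ly :: w)) sgn (size p.1) (F (rev p.1) *
     \sum_(t <- splits p.2) if ally t.1 then ysum f t.1 * F t.2 else 0))).
apply: NPD; first by apply: NP_N; exact: symsum_expand.
rewrite /symsum -sumrB big_seq; elim/big_ind: _ => // p /mem_splits hp.
have wp : wf (rev p.1).
  by case: p.1 hp => [//|y s] /= [-> _]; rewrite /wf rev_cons last_rcons.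
have -> : atY (fun u => sgn (size p.1) (F u * F (rev p.1))) p.2 =
  sgn (size p.1) (F (rev p.1) * atY (fun u => F u) p.2).
  by case: p.2 => [|[] s] /=; rewrite ?mulr0 /sgn ?oppr0 ?if_same // mulrC.
rewrite -sgnB -mulrBr.
suff h : NP (F (rev p.1) * (\sum_(t <- splits p.2) (if ally t.1 then ysum f t.1 * F t.2 else 0)
   - atY [eta F] p.2)) by rewrite /sgn; case: odd => //; exact: NPN.
have y0 : ysum f [::] = 0 by rewrite /ysum big_seq1.
have y1 : ysum f [:: Ly] = 1.
  by rewrite /ysum /= !big_cons big_nil /= !addr0 f_nil mulr1.
have main q s : wf s -> NP (F (rev p.1) * (ysum f (nseq q.+2 Ly) * F s)).
  by move=> hs; rewrite mulrCA; exact: NP_ysum.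
have ws : wf p.2 by apply: (@wf_suffix p.1); rewrite hp; move: hw; rewrite /wf; case: (w).
case e: p.2 ws => [|[] s] /= ws.
- by rewrite big_seq1 /= y0 mul0r subr0 mulr0.
- by rewrite big_cons big_map /= y0 mul0r big1 // !addr0 subr0 mulr0.
rewrite big_cons big_map /= y0 mul0r add0r.
have ws' : wf s by apply: (@wf_suffix [:: Ly]).
case: s ws' {ws e} => [|x s] ws'; first by rewrite big_seq1 /= y1 mul1r subrr mulr0.
rewrite /= big_cons big_map /= y1 mul1r addrC addKr mulr_sumr.
rewrite big_seq; elim/big_ind: _ => // t /mem_splits ht.
case: ifP => h; last by rewrite mulr0.
have /andP[/eqP -> /ally_nseq ->] : (x == Ly) && ally t.1 by [].
apply: (main (size t.1)); apply: (@wf_suffix (x :: t.1)).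
by rewrite /= ht.
Qed.

Lemma symsum_shuffle_mod a b : wf a -> wf b ->
  NP (sgn (size b) (symsum f (rev b ++ Ly :: a)) - shsum (fun m => symsum f (Ly :: m)) a b).
Proof.
move=> ha hb.
(* [symsum_reg] wants a leading y. The reversal of b supplies it, as b ends in y; if b is empty, the
   adjoined y does. *)
have [w hw e] : exists2 w, wf w & rev b ++ Ly :: a = Ly :: w.
  case/lastP: b hb => [|b y] hb; first by exists a.
  move: hb; rewrite /wf last_rcons rev_rcons /= => /eqP ->.
  by exists (rev b ++ Ly :: a) => //; rewrite /wf last_cat.
have NPsgn n (z : K) : NP z -> NP (sgn n z) by rewrite /sgn; case: odd => // ?; exact: NPN.
rewrite -(subrKA (sgn (size b) (symsum F (rev b ++ Ly :: a)))); apply: NPD.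
  by rewrite -sgnB e; apply: NPsgn; exact: symsum_reg.
rewrite -(subrKA (shsum (fun m => symsum F (Ly :: m)) a b)); apply: NPD.
  by rewrite -opprB; apply: NPN; apply: NP_N; exact: symsum_shuffle.
rewrite -opprB; apply: NPN; rewrite /shsum -sumrB big_seq; elim/big_ind: _ => //.
  exact: NP_N.
by move=> m hm; apply: symsum_reg; exact: (wf_shR hm).
Qed.

End Symmetric.

(** * Nested sums *)

Section NestedSums.
Variable K : comNzRingType.
Implicit Types (z k l : seq nat) (s t : seq K).

(* The letters of [z], in order, are the exponents of an ordered subfamily of [s]. *)
Fixpoint nsum z s {struct s} : K :=
  match s, z with
  | _, [::] => 1
  | [::], _ :: _ => 0
  | c :: s', u :: z' => nsum z s' + c ^+ u * nsum z' s'
  end.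

Lemma nsum_nil s : nsum [::] s = 1. Proof. by case: s. Qed.

Lemma harmR_cons u x v y : harmR (u :: x) (v :: y) =
  map (cons u) (harmR x (v :: y)) ++ map (cons v) (harmR (u :: x) y)
  ++ map (cons (u + v)%N) (harmR x y).
Proof. by []. Qed.

(** The first point c carries no letter, a letter of k, a letter of l, or one of each; the last case
    merges into the exponent u + v. The terms without c are the induction hypothesis for the same
    two words. *)
Lemma nsum_harmR s k l : \sum_(m <- harmR k l) nsum m s = nsum k s * nsum l s.
Proof.
elim: s k l => [|c s IH] k l.
  case: k l => [|u k] [|v l]; rewrite ?big_seq1 ?mulr1 ?mul1r //.
  by rewrite harmR_cons !big_cat !big_map /= !big1 // !addr0 mul0r.
case: k => [|u k]; first by rewrite big_seq1 nsum_nil mul1r.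
case: l => [|v l]; first by rewrite big_seq1 nsum_nil mulr1.
have h w (r : seq (seq nat)) : \sum_(i <- r) nsum (w :: i) (c :: s) =
    \sum_(i <- r) nsum (w :: i) s + c ^+ w * \sum_(i <- r) nsum i s.
  by rewrite big_split mulr_sumr.
have cat (r1 r2 : seq (seq nat)) (F : seq nat -> K) :
    \sum_(i <- r1 ++ r2) F i = \sum_(i <- r1) F i + \sum_(i <- r2) F i by exact: big_cat.
have := IH (u :: k) (v :: l); rewrite harmR_cons !cat !big_map !h !IH => e.
transitivity (nsum (u :: k) s * nsum (v :: l) s +
   c ^+ u * (nsum k s * nsum (v :: l) s) + c ^+ v * (nsum (u :: k) s * nsum l s) +
   c ^+ (u + v) * (nsum k s * nsum l s)); last first.
  by rewrite [nsum _ (c :: s)]/= [in RHS]/= exprD; ring.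
by rewrite -e; ring.
Qed.

Lemma nsum_cat z s t :
  nsum z (s ++ t) = \sum_(p <- splits z) nsum p.1 s * nsum p.2 t.
Proof.
elim: s z => [|c s IH] z.
  case: z => [|u z]; first by rewrite big_seq1 !nsum_nil mulr1.
  rewrite (splits_cons (fun a b => nsum a [::] * nsum b t)) nsum_nil mul1r.
  by rewrite big1 ?addr0 // => p _; rewrite mul0r.
case: z => [|u z]; first by rewrite big_seq1 !nsum_nil mulr1.
rewrite /= !IH (splits_cons (fun a b => nsum a s * nsum b t)).
rewrite big_cons big_map /= nsum_nil !mul1r -addrA; congr (_ + _).
rewrite mulr_sumr -big_split; apply: eq_bigr => p _ /=.
by rewrite mulrDl mulrA.
Qed.

Lemma nsum_rcons z s c : nsum z (rcons s c) =
  nsum z s + (if z is _ :: _ then c ^+ last 0%N z * nsum (belast (head 0%N z) (behead z)) s else 0).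
Proof.
case/lastP: z => [|z u]; first by rewrite !nsum_nil addr0.
rewrite -[rcons s c]cats1 nsum_cat (splits_rcons (fun a b => nsum a s * nsum b [:: c])) nsum_nil mulr1.
rewrite addrC; congr (_ + _).
have key (g : seq nat -> K) y :
    \sum_(p <- splits y) g p.1 * nsum (rcons p.2 u) [:: c] = c ^+ u * g y.
  elim: y g => [|v y IH] g.
    by rewrite big_seq1 /= mulr1 add0r mulrC.
  rewrite (splits_cons (fun a b => g a * nsum (rcons b u) [:: c])) (IH (fun a => g (v :: a))).
  by rewrite /=; case: (rcons y u) (size_rcons y u) => // ? ? _ /=; rewrite mulr0 addr0 mulr0 add0r.
rewrite (key (nsum^~ s)).
by case: z => [|v z] /=; rewrite ?last_rcons ?belast_rcons.
Qed.

Lemma nsum_rev z s : nsum (rev z) (rev s) = nsum z s.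
Proof.
elim: s z => [|c s IH] z.
  by case: z => // u z; rewrite rev_cons; case: (rev z).
rewrite rev_cons nsum_rcons IH; case: z => [|u z]; first by rewrite !nsum_nil addr0.
rewrite /= rev_cons; congr (_ + _).
case e: (rcons (rev z) u) (size_rcons (rev z) u) => [//|a w] _ /=.
have [<- <-] : (rev z, u) = (belast a w, last a w) by apply: rcons_inj; rewrite e lastI.
by rewrite IH.
Qed.

Lemma nsum_opp z s : nsum z (map -%R s) = (-1) ^+ sumn z * nsum z s.
Proof.
elim: s z => [|c s IH] [|u z] //=; rewrite ?mul1r ?mulr0 //.
by rewrite !IH /= [(- c) ^+ _]exprNn exprD; ring.
Qed.

Lemma nsum_letter u s : nsum [:: u] s = \sum_(c <- s) c ^+ u.
Proof.
by elim: s => [|c s IH]; rewrite ?big_nil // big_cons -IH /= nsum_nil mulr1 addrC.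
Qed.

(** Newton's identities: [nsum] at (1, ..., 1) is an elementary symmetric function. The induction
    adds one point c. *)
Lemma nsum_newton n s : n%:R * nsum (nseq n 1%N) s =
  \sum_(j < n) (-1) ^+ j * (\sum_(c <- s) c ^+ j.+1) * nsum (nseq (n - j.+1) 1%N) s.
Proof.
pose E n s := nsum (nseq n 1%N) s; pose p j s := \sum_(c <- s) c ^+ j : K.
rewrite -[LHS]/(n%:R * E n s) -[RHS]/(\sum_(j < n) (-1) ^+ j * p j.+1 s * E (n - j.+1)%N s).
have Ec m c t : E m.+1 (c :: t) = E m.+1 t + c * E m t by rewrite /E /= expr1.
elim: s n => [|c s IH] n.
  case: n => [|n]; first by rewrite big_ord0 mul0r.
  by rewrite /E /= mulr0 big1 // => j _; rewrite /p big_nil mulr0 mul0r.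
case: n => [|n]; first by rewrite big_ord0 mul0r.
have eA : \sum_(j < n.+1) (-1) ^+ j * p j.+1 s * E (n.+1 - j.+1)%N (c :: s) =
  \sum_(j < n.+1) (-1) ^+ j * p j.+1 s * E (n.+1 - j.+1)%N s +
  c * \sum_(j < n) (-1) ^+ j * p j.+1 s * E (n - j.+1)%N s.
  rewrite big_ord_recr [in RHS]big_ord_recr /= subnn addrAC; congr (_ + _); last by rewrite /E !nsum_nil.
  rewrite mulr_sumr -big_split; apply: eq_bigr => j _ /=.
  have -> : (n.+1 - j.+1 = (n - j.+1).+1)%N by rewrite subSS subnSK.
  by rewrite Ec; ring.
(* The part that c adds to the power sums; expanding with [Ec] collapses this alternating sum. *)
have eB m : \sum_(j < m.+1) (-1) ^+ j * c ^+ j.+1 * E (m.+1 - j.+1)%N (c :: s) = c * E m s.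
  elim: m => [|m IHm].
    by rewrite big_ord1 /= /E !nsum_nil expr0 expr1 mul1r.
  rewrite big_ord_recl /= expr0 mul1r expr1 subSS subn0.
  rewrite (eq_bigr (fun j : 'I_m.+1 => - c * ((-1) ^+ j * c ^+ j.+1 * E (m.+1 - j.+1)%N (c :: s)))).
    by rewrite -mulr_sumr IHm Ec; ring.
  by move=> j _; rewrite /bump /= add1n subSS !exprS; ring.
rewrite (eq_bigr (fun j : 'I_n.+1 => (-1) ^+ j * p j.+1 s * E (n.+1 - j.+1)%N (c :: s) +
    (-1) ^+ j * c ^+ j.+1 * E (n.+1 - j.+1)%N (c :: s))); last first.
  by move=> j _; rewrite /p big_cons; ring.
by rewrite big_split /= eA eB -IH -IH Ec [n.+1%:R]mulrSr; ring.
Qed.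

End NestedSums.

(** * The q-shuffle product *)

Section Operators.
Variable R : realType.
Local Notation C := R[i].
Variable q : C.
Hypothesis q_lt1 : `|q| < 1.
Implicit Types (c d : nat -> C).

(** F_q(m; g_k) is the k-th power of this number, so that g_k = b a^k becomes k applications of
    [opA] after [opB]. *)
Definition hq (m : nat) : C := q ^+ m / qint q m.

(* Power series are identified with their coefficient sequences; [opA] is the q-integral a,
   [opB] is the multiplication by t / (1 - t), and [conv] is the product. *)
Definition opA c : nat -> C := fun m => hq m * c m.
Definition opB c : nat -> C := fun m => \sum_(i < m) c i.
Definition opH c : nat -> C := fun m => (1 - q) * c m.
Definition conv c d : nat -> C := fun m => \sum_(i < m.+1) c i * d (m - i)%N.
Definition delta : nat -> C := fun m => (m == 0%N)%:R.

Lemma opA_D c d : opA (c + d) = opA c + opA d.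
Proof. by apply: funext => m; rewrite /opA !fctE mulrDr. Qed.
Lemma opB_D c d : opB (c + d) = opB c + opB d.
Proof. by apply: funext => m; rewrite /opB !fctE -big_split. Qed.
Lemma opA_N c : opA (- c) = - opA c.
Proof. by apply: funext => m; rewrite /opA !fctE mulrN. Qed.
Lemma opB_N c : opB (- c) = - opB c.
Proof. by apply: funext => m; rewrite /opB !fctE -sumrN. Qed.
Lemma opA_0 : opA 0 = 0.
Proof. by apply: funext => m; exact: mulr0. Qed.
Lemma opB_0 : opB 0 = 0.
Proof. by apply: funext => m; rewrite /opB big1. Qed.
Lemma opA_sum (I : Type) (r : seq I) (F : I -> nat -> C) :
  opA (\sum_(i <- r) F i) = \sum_(i <- r) opA (F i).
Proof. by rewrite (big_morph _ opA_D opA_0). Qed.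
Lemma opB_sum (I : Type) (r : seq I) (F : I -> nat -> C) :
  opB (\sum_(i <- r) F i) = \sum_(i <- r) opB (F i).
Proof. by rewrite (big_morph _ opB_D opB_0). Qed.

Lemma convC c d : conv c d = conv d c.
Proof.
apply: funext => m; rewrite /conv (reindex_inj rev_ord_inj) /=.
by apply: eq_bigr => i _; rewrite subSS subKn 1?mulrC // -ltnS.
Qed.

Lemma conv_Dl c c' d : conv (c + c') d = conv c d + conv c' d.
Proof.
apply: funext => m; rewrite /conv !fctE -big_split.
by apply: eq_bigr => i _; rewrite mulrDl.
Qed.
Lemma conv_Dr c d d' : conv c (d + d') = conv c d + conv c d'.
Proof. by rewrite convC conv_Dl !(convC c). Qed.
Lemma conv_0r c : conv c 0 = 0.
Proof. by apply: funext => m; rewrite /conv big1 // => i _; rewrite mulr0. Qed.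
Lemma conv_sumr (I : Type) (r : seq I) (F : I -> nat -> C) c :
  conv c (\sum_(i <- r) F i) = \sum_(i <- r) conv c (F i).
Proof. by rewrite (big_morph _ (conv_Dr c) (conv_0r c)). Qed.

Lemma conv_delta d : conv delta d = d.
Proof.
apply: funext => m; rewrite /conv big_ord_recl /delta /= mul1r subn0 big1 ?addr0 //.
by move=> i _; rewrite mul0r.
Qed.

Lemma conv_opB c d : conv (opB c) d = opB (conv c d).
Proof.
apply: funext; elim=> [|m IH].
  by rewrite /conv /opB big_ord1 !big_ord0 mul0r.
transitivity (conv (opB c) d m + conv c d m); last by rewrite IH /opB big_ord_recr.
rewrite {1}/conv big_ord_recl {1}/opB big_ord0 mul0r add0r /conv -big_split.
apply: eq_bigr => i _ /=.
by rewrite /bump /= add1n subSS -mulrDl -[opB c i.+1]/(\sum_(j < i.+1) c j) big_ord_recr.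
Qed.

Lemma expq_neq1 m : (0 < m)%N -> 1 - q ^+ m != 0.
Proof.
move=> m0; rewrite subr_eq0 eq_sym; apply/eqP => e.
have : `|q ^+ m| < 1 by rewrite normrX exprn_ilt1 // -lt0n.
by rewrite e normr1 ltxx.
Qed.

Lemma onemq_neq0 : 1 - q != 0.
Proof. by have := @expq_neq1 1 isT; rewrite expr1. Qed.

(** [0] = 0 and division by zero returns 0, so [opA] kills constant terms. *)
Lemma hq0 : hq 0 = 0.
Proof. by rewrite /hq /qint expr0 subrr mul0r invr0 mulr0. Qed.

(** A partial fraction identity. Its summand 1 - q is the source of all hbar corrections to the
    classical shuffle product. *)
Lemma hq_mul i j : (0 < i)%N -> (0 < j)%N ->
  hq i * hq j = hq (i + j) * (hq i + hq j + (1 - q)).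
Proof.
move=> i0 j0.
have hi := expq_neq1 i0; have hj := expq_neq1 j0; have h1 := onemq_neq0.
have := @expq_neq1 (i + j); rewrite addn_gt0 i0 => /(_ isT).
rewrite /hq /qint exprD; move: (q ^+ i) (q ^+ j) hi hj => x y hi hj hxy.
by field; rewrite h1 hi hj hxy.
Qed.

(* The Rota-Baxter relation of the q-integral, i.e. the recursion of the q-shuffle product. *)
Lemma conv_opA c d : c 0%N = 0 -> d 0%N = 0 -> conv (opA c) (opA d) =
  opA (conv c (opA d) + conv (opA c) d + opH (conv c d)).
Proof.
move=> c0 d0; apply: funext => m; rewrite /opA /opH !fctE /conv.
rewrite mulr_sumr -!big_split mulr_sumr; apply: eq_bigr => i _ /=.
(* [hq_mul] requires positive indices; the vanishing constant terms take care of both ends of the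
   sum. *)
have [->|i0] := posnP i; first by rewrite c0 !(mulr0, mul0r, addr0).
have hi : (i <= m)%N by rewrite -ltnS.
have [e|j0] := posnP (m - i)%N; first by rewrite e d0 !(mulr0, mul0r, addr0).
have e := hq_mul i0 j0; rewrite subnKC // in e.
by rewrite mulrACA e; ring.
Qed.

Lemma opB0 c : opB c 0%N = 0. Proof. exact: big_ord0. Qed.

Lemma conv_opA3 c d : c 0%N = 0 -> d 0%N = 0 -> conv (opA c) (opA d) =
  opA (conv c (opA d)) + opA (conv (opA c) d) + opA (opH (conv c d)).
Proof. by move=> c0 d0; rewrite conv_opA // !opA_D. Qed.

Lemma conv_opAB c d : d 0%N = 0 -> conv (opA (opB c)) (opA d) =
  opA (opB (conv c (opA d))) + opA (conv (opA (opB c)) d) + opA (opH (opB (conv c d))).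
Proof. by move=> d0; rewrite conv_opA3 ?opB0 // !conv_opB. Qed.

(** Here x stands for a and y for ba. Entry m is the part of the nested sum whose largest variable
    equals m; the partial sums of these entries are the truncated values. *)
Fixpoint phi (u : seq xy) : nat -> C :=
  match u with
  | [::] => delta
  | Lx :: u' => opA (phi u')
  | Ly :: u' => opA (opB (phi u'))
  end.

Fixpoint cw (w : seq Alet) : nat -> C :=
  match w with
  | [::] => delta
  | Hb :: w' => opH (opB (cw w'))
  | G k :: w' => iter k opA (opB (cw w'))
  end.

Lemma iter_opA k c m : iter k opA c m = hq m ^+ k * c m.
Proof. by elim: k => [|k IH]; rewrite ?mul1r //= /opA IH exprS mulrA. Qed.

Lemma cw_cons u w m : cw (u :: w) m = opB (cw w) m * Fq q m u.
Proof.
case: u => [|k]; first by rewrite /= /opH mulrC.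
by rewrite /= iter_opA mulrC /hq exprMn exprVn -exprM mulnC.
Qed.

Lemma ZqMrev_cw w M : (0 < M)%N -> ZqMrev q w M = \sum_(m < M) cw w m.
Proof.
elim: w M => [|u w IH] [//|M] _.
  by rewrite big_ord_recl big1 ?addr0.
rewrite big_ord_recl cw_cons /opB big_ord0 mul0r add0r.
rewrite -[ZqMrev _ _ _]/(\sum_(1 <= m < M.+1) ZqMrev q w m * Fq q m u).
rewrite big_add1 big_mkord; apply: eq_bigr => i _.
by rewrite cw_cons IH // /bump add1n.
Qed.

Lemma phi_rev_zword k : index_pos k -> phi (rev (zword k)) = cw (rev (gword k)).
Proof.
elim/last_ind: k => [//|k n IH].
rewrite /index_pos all_rcons => /andP[n0 /IH IHk].
rewrite /zword map_rcons flatten_rcons rev_cat /gword map_rcons rev_rcons /= -IHk.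
rewrite rev_cons rev_nseq; case: n n0 => // n _ /=; rewrite cat_rcons.
by elim: n => //= n ->.
Qed.

Lemma phi0 u : wf u -> u != [::] -> phi u 0%N = 0.
Proof. by case: u => [//|[] u] _ _; rewrite /= /opA hq0 mul0r. Qed.

Definition headG (w : seq Alet) : bool := if w is Hb :: _ then false else true.
Definition hat (w : seq Alet) : bool := Aword_valid w && headG w.
Definition hashb : pred (seq Alet) := has (fun u => if u is Hb then true else false).
(** The condition s <= t in the definition of n_0: some g_k with k >= 2 has a letter hbar b before
    it, hence after it in the reversed word. *)
Fixpoint n0r (w : seq Alet) : bool :=
  match w with
  | [::] => false
  | Hb :: w' => n0r w'
  | G k :: w' => (1 < k)%N && hashb w' || n0r w'
  end.

(* The spanning monomials, with words reversed: of n; of the words of \hat{H^0} (nonempty,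
   and containing a factor hbar); of \hat{H^0}. *)
Definition Nmono (e : nat) (w : seq Alet) : bool := hat w && ((0 < e)%N || n0r w).
Definition Kmono (e : nat) (w : seq Alet) : bool :=
  [&& hat w, ~~ nilp w & (0 < e)%N || hashb w].
Definition Hmono (e : nat) (w : seq Alet) : bool := hat w.

(** * Spans of monomials and their stability under the operators *)

Definition sv (X : fs) : nat -> C :=
  fun m => \sum_(t <- X) ratr t.1.1 * (1 - q) ^+ t.1.2 * cw t.2 m.

(** A property of coefficient sequences, not of formal sums, so that identities between sequences
    apply without being lifted to words. *)
Definition inspan (P : nat -> seq Alet -> bool) c : Prop :=
  exists2 X : fs, all (fun t => P t.1.2 t.2) X & c = sv X.

Section Span.
Variable P : nat -> seq Alet -> bool.

Lemma inspan0 : inspan P 0.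
Proof. by exists [::] => //; apply: funext => m; rewrite /sv big_nil. Qed.

Lemma inspanD c d : inspan P c -> inspan P d -> inspan P (c + d).
Proof.
move=> [X hX ->] [Y hY ->]; exists (X ++ Y); first by rewrite all_cat hX hY.
by apply: funext => m; rewrite /sv big_cat.
Qed.

Lemma inspanN c : inspan P c -> inspan P (- c).
Proof.
move=> [X hX ->]; exists [seq (- t.1.1, t.1.2, t.2) | t <- X].
  by rewrite all_map.
apply: funext => m; rewrite /sv big_map !fctE -sumrN.
by apply: eq_bigr => t _ /=; rewrite rmorphN !mulNr.
Qed.

Lemma inspan_sum (I : eqType) (r : seq I) (F : I -> nat -> C) :
  (forall i, i \in r -> inspan P (F i)) -> inspan P (\sum_(i <- r) F i).
Proof.
move=> h; rewrite big_seq; elim/big_ind: _ => //; first exact: inspan0.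
exact: inspanD.
Qed.

Lemma inspan_cw w : P 0 w -> inspan P (cw w).
Proof.
move=> h; exists [:: (1, 0%N, w)]; first by rewrite /= h.
by apply: funext => m; rewrite /sv big_seq1 rmorph1 !mul1r.
Qed.
End Span.

(** Common pattern of the stability lemmas: a linear operator that sends each spanning word w to
    hbar^e0 [om] w. *)
Lemma inspan_op (P Q : nat -> seq Alet -> bool) (O : (nat -> C) -> nat -> C)
    (e0 : nat) (om : seq Alet -> seq Alet) :
  (forall a c d, O (fun m => a * c m + d m) = (fun m => a * O c m + O d m)) -> O 0 = 0 ->
  (forall e w, P e w -> Q (e + e0)%N (om w)) ->
  (forall e w, P e w -> O (cw w) = (fun m => (1 - q) ^+ e0 * cw (om w) m)) ->
  forall c, inspan P c -> inspan Q (O c).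
Proof.
move=> Olin O0 hPQ hO c [X hX ->].
exists [seq (t.1.1, (t.1.2 + e0)%N, om t.2) | t <- X].
  by rewrite all_map; apply: sub_all hX => t; exact: hPQ.
elim: X hX => [_|t X IH /= /andP[ht hX]].
  by rewrite (_ : sv [::] = 0) ?O0 //; apply: funext => m; rewrite /sv big_nil.
rewrite (_ : sv (t :: X) = (fun m => ratr t.1.1 * (1 - q) ^+ t.1.2 * cw t.2 m + sv X m)).
  rewrite Olin IH // (hO _ _ ht); apply: funext => m.
  by rewrite [RHS]big_cons /= exprD !mulrA.
by apply: funext => m; rewrite /sv big_cons.
Qed.

Lemma opA_lin a c d : opA (fun m => a * c m + d m) = (fun m => a * opA c m + opA d m).
Proof. by apply: funext => m; rewrite /opA mulrDr mulrCA. Qed.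
Lemma opB_lin a c d : opB (fun m => a * c m + d m) = (fun m => a * opB c m + opB d m).
Proof. by apply: funext => m; rewrite /opB big_split /= mulr_sumr. Qed.
Lemma opH_lin a c d : opH (fun m => a * c m + d m) = (fun m => a * opH c m + opH d m).
Proof. by apply: funext => m; rewrite /opH mulrDr mulrCA. Qed.
Lemma opH_0 : opH 0 = 0.
Proof. by apply: funext => m; rewrite /opH mulr0. Qed.

Definition incr (w : seq Alet) : seq Alet :=
  if w is G k :: w' then G k.+1 :: w' else w.

(** On the empty word [opA] gives 0, which is not the series of a word; this is why [Kmono] and
    [Hposmono] ask for at least one letter. *)
Lemma cw_incr w : hat w -> ~~ nilp w -> opA (cw w) = cw (incr w).
Proof. by case: w => [//|[|k] w] /andP[_ h]. Qed.

Lemma hat_incr w : hat w -> hat (incr w).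
Proof. by case: w => [//|[//|k] w] /andP[/andP[_ h] _]; rewrite /hat /= andbT. Qed.

Lemma hat_g1 w : Aword_valid w -> hat (G 1 :: w).
Proof. by rewrite /hat /= andbT. Qed.

Lemma opA_KK c : inspan Kmono c -> inspan Kmono (opA c).
Proof.
apply: (inspan_op (e0 := 0) (om := incr)); [exact: opA_lin|exact: opA_0|..].
  move=> e w /and3P[h1 h2 h3]; rewrite /Kmono hat_incr // addn0.
  by case: w h1 h2 h3 => [//|[//|k] w].
by move=> e w /and3P[h1 h2 _]; rewrite cw_incr //; apply: funext => m; rewrite mul1r.
Qed.

(** Appending a turns the last letter g_k into g_(k+1) with k + 1 >= 2, so any hbar b in the word
    now precedes such a letter: the pattern of n_0. *)
Lemma opA_KN c : inspan Kmono c -> inspan Nmono (opA c).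
Proof.
apply: (inspan_op (e0 := 0) (om := incr)); [exact: opA_lin|exact: opA_0|..].
  move=> e w /and3P[h1 h2 h3]; rewrite /Nmono hat_incr // addn0.
  case: w h1 h2 h3 => [|[|k] w] // /andP[/andP[/= k0 _]] // _ _.
  by rewrite /= ltnS k0 /= orbA => ->.
by move=> e w /and3P[h1 h2 _]; rewrite cw_incr //; apply: funext => m; rewrite mul1r.
Qed.

Lemma AB_lin a c d : opA (opB (fun m => a * c m + d m)) =
  (fun m => a * opA (opB c) m + opA (opB d) m).
Proof. by rewrite opB_lin opA_lin. Qed.

Lemma AB_KK c : inspan Kmono c -> inspan Kmono (opA (opB c)).
Proof.
apply: (inspan_op (O := opA \o opB) (e0 := 0) (om := cons (G 1))).
- exact: AB_lin.
- by rewrite /= opB_0 opA_0.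
- by move=> e w /and3P[/andP[h1 _] h2 h3]; rewrite /Kmono hat_g1 // addn0.
by move=> e w _; apply: funext => m; rewrite mul1r.
Qed.

Lemma AB_NN c : inspan Nmono c -> inspan Nmono (opA (opB c)).
Proof.
apply: (inspan_op (O := opA \o opB) (e0 := 0) (om := cons (G 1))).
- exact: AB_lin.
- by rewrite /= opB_0 opA_0.
- by move=> e w /andP[/andP[h1 _] h2]; rewrite /Nmono hat_g1 // addn0.
by move=> e w _; apply: funext => m; rewrite mul1r.
Qed.

Lemma HAB_HN c : inspan Hmono c -> inspan Nmono (opA (opH (opB c))).
Proof.
apply: (inspan_op (O := opA \o (opH \o opB)) (e0 := 1) (om := cons (G 1))).
- by move=> a c' d'; rewrite /= opB_lin opH_lin opA_lin.
- by rewrite /= opB_0 opH_0 opA_0.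
- by move=> e w /andP[h1 _]; rewrite /Nmono hat_g1 // addn1.
by move=> e w _; apply: funext => m; rewrite /= /opA /opH expr1 mulrCA.
Qed.

Lemma HAB_HK c : inspan Hmono c -> inspan Kmono (opA (opH (opB c))).
Proof.
apply: (inspan_op (O := opA \o (opH \o opB)) (e0 := 1) (om := cons (G 1))).
- by move=> a c' d'; rewrite /= opB_lin opH_lin opA_lin.
- by rewrite /= opB_0 opH_0 opA_0.
- by move=> e w /andP[h1 _]; rewrite /Kmono hat_g1 // addn1.
by move=> e w _; apply: funext => m; rewrite /= /opA /opH expr1 mulrCA.
Qed.

Lemma ABHB_HK c : inspan Hmono c -> inspan Kmono (opA (opB (opH (opB c)))).
Proof.
apply: (inspan_op (O := opA \o (opB \o (opH \o opB))) (e0 := 0) (om := fun w => G 1 :: Hb :: w)).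
- by move=> a c' d'; rewrite /= opB_lin opH_lin opB_lin opA_lin.
- by rewrite /= opB_0 opH_0 opB_0 opA_0.
- by move=> e w /andP[h1 _]; rewrite /Kmono /hat /= h1 orbT.
by move=> e w _; apply: funext => m; rewrite mul1r.
Qed.

Definition Hposmono (e : nat) (w : seq Alet) : bool := hat w && ~~ nilp w.

Lemma H_HposK c : inspan Hposmono c -> inspan Kmono (opH c).
Proof.
apply: (inspan_op (e0 := 1) (om := id)); [exact: opH_lin|exact: opH_0|..].
  by move=> e w /andP[h1 h2]; rewrite /Kmono h1 h2 addn1.
by move=> e w _; apply: funext => m; rewrite /opH expr1.
Qed.

Lemma inspan_sub (P Q : nat -> seq Alet -> bool) c :
  (forall e w, P e w -> Q e w) -> inspan P c -> inspan Q c.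
Proof. by move=> h [X hX ->]; exists X => //; apply: sub_all hX => t; exact: h. Qed.

Lemma cw_zphi u : wf u -> exists2 w, phi u = cw w & hat w && (nilp w == nilp u).
Proof.
elim: u => [|[] u IH] hu; first by exists [::].
- have hu' : wf u by move: hu; rewrite /wf; case: (u).
  have [w e /andP[h1 /eqP h2]] := IH hu'.
  have hn : ~~ nilp w by rewrite h2; move: hu; rewrite /wf; case: (u).
  exists (incr w); first by rewrite /= e cw_incr.
  by rewrite hat_incr //; case: w h1 hn {e h2} => [//|[|k] w].
have hu' : wf u by move: hu; rewrite /wf; case: (u).
have [w e /andP[/andP[h1 _] h2]] := IH hu'.
by exists (G 1 :: w); rewrite /= ?e ?hat_g1.
Qed.

Lemma inspan_phi u : wf u -> inspan Hmono (phi u).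
Proof. by move=> /cw_zphi[w -> /andP[h _]]; exact: inspan_cw. Qed.

Lemma inspan_phi_pos u : wf u -> u != [::] -> inspan Hposmono (phi u).
Proof.
move=> /cw_zphi[w -> /andP[h1 /eqP h2]] hu; apply: inspan_cw.
by rewrite /Hposmono h1 h2; case: u hu {h2}.
Qed.

Lemma wf_behead x u : wf (x :: u) -> wf u.
Proof. exact: (@wf_suffix [:: x]). Qed.

Lemma wf_x u : wf (Lx :: u) -> u != [::].
Proof. by case: u. Qed.

Lemma K_Hpos c : inspan Kmono c -> inspan Hposmono c.
Proof. by apply: inspan_sub => e w /and3P[h1 h2 _]; rewrite /Hposmono h1. Qed.
Lemma Hpos_H c : inspan Hposmono c -> inspan Hmono c.
Proof. by apply: inspan_sub => e w /andP[]. Qed.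

(** Induction through the Rota-Baxter relation: its first two terms reproduce the recursion of the
    shuffle product, and the third carries a factor hbar. *)
Lemma phi_shuffle u v : wf u -> wf v ->
  inspan Kmono (conv (phi u) (phi v) - shsum phi u v).
Proof.
elim: u v => [|x u IHu] v hu hv.
  by rewrite shsum0l conv_delta subrr; exact: inspan0.
elim: v hv => [|y v IHv] hv.
  by rewrite shsum0r convC conv_delta subrr; exact: inspan0.
have hu' := wf_behead hu; have hv' := wf_behead hv.
have k1 := IHu _ hu' hv; have k2 := IHv hv'.
have prodH a b : wf a -> wf b ->
    inspan Kmono (conv (phi a) (phi b) - shsum phi a b) ->
    inspan Hmono (conv (phi a) (phi b)).
  move=> ha hb hK; rewrite -[conv _ _](subrK (shsum phi a b)); apply: inspanD.
    exact/Hpos_H/K_Hpos.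
  by apply: inspan_sum => m hm; apply: inspan_phi; exact: (wf_shR hm).
have prodHpos a b : wf a -> wf b -> b != [::] ->
    inspan Kmono (conv (phi a) (phi b) - shsum phi a b) ->
    inspan Hposmono (conv (phi a) (phi b)).
  move=> ha hb nb hK; rewrite -[conv _ _](subrK (shsum phi a b)); apply: inspanD.
    exact/K_Hpos.
  apply: inspan_sum => m hm; apply: inspan_phi_pos; first exact: (wf_shR hm).
  by have := size_shR hm; case: m {hm} => //; case: b nb {hb hK} => //= ? ? _; rewrite addnS.
have kuv : inspan Kmono (conv (phi u) (phi v) - shsum phi u v) by exact: IHu.
have key c d e : conv (phi (x :: u)) (phi (y :: v)) = c + d + e ->
    inspan Kmono (c - shsum (phi \o cons x) u (y :: v)) ->
    inspan Kmono (d - shsum (phi \o cons y) (x :: u) v) -> inspan Kmono e ->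
    inspan Kmono (conv (phi (x :: u)) (phi (y :: v)) - shsum phi (x :: u) (y :: v)).
  move=> -> h1 h2 h3; rewrite shsum_cons.
  rewrite (_ : _ - _ = (c - shsum (phi \o cons x) u (y :: v)) +
    (d - shsum (phi \o cons y) (x :: u) v) + e); last by rewrite opprD addrAC addrACA.
  by apply: inspanD => //; exact: inspanD.
have sh0 (O : (nat -> C) -> nat -> C) g a b : (forall (r : seq (seq xy)), O (\sum_(i <- r) phi i) = \sum_(i <- r) O (phi i)) ->
   (forall m, g m = O (phi m)) -> shsum g a b = O (shsum phi a b).
  by move=> h1 h2; rewrite /shsum h1; apply: eq_bigr => m _; rewrite h2.
have ABs (r : seq (seq xy)) : opA (opB (\sum_(i <- r) phi i)) = \sum_(i <- r) opA (opB (phi i)).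
  by rewrite opB_sum opA_sum.
have AK a b : inspan Kmono (conv (phi a) (phi b) - shsum phi a b) ->
    inspan Kmono (opA (conv (phi a) (phi b)) - shsum (phi \o cons Lx) a b).
  move=> h; rewrite (sh0 opA) //; last by move=> r; rewrite opA_sum.
  by rewrite -opA_N -opA_D; exact: opA_KK.
have ABK a b : inspan Kmono (conv (phi a) (phi b) - shsum phi a b) ->
    inspan Kmono (opA (opB (conv (phi a) (phi b))) - shsum (phi \o cons Ly) a b).
  move=> h; rewrite (sh0 (opA \o opB)) //=.
  by rewrite -opA_N -opB_N -opA_D -opB_D; exact: AB_KK.
have H0 w : wf (Lx :: w) -> phi w 0%N = 0 by move=> hw; rewrite phi0 ?wf_x //; exact: wf_behead hw.
clear IHu IHv sh0; case: x y hu hv k1 k2 key => -[] hu hv k1 k2 key.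
- apply: (key _ _ _ (conv_opA3 (H0 _ hu) (H0 _ hv)) (AK _ _ k1) (AK _ _ k2)).
  by apply/opA_KK/H_HposK/prodHpos => //; exact: wf_x.
- have e : conv (opA (phi u)) (opA (opB (phi v))) =
      opA (conv (phi u) (opA (opB (phi v)))) + opA (opB (conv (opA (phi u)) (phi v))) +
      opA (opH (opB (conv (phi u) (phi v)))).
    rewrite convC (conv_opAB _ (H0 _ hu)) [X in X + _]addrC [conv (opA (opB _)) (phi u)]convC.
    by rewrite [conv (phi v) (opA _)]convC [conv (phi v) (phi u)]convC.
  apply: (key _ _ _ e (AK _ _ k1) (ABK _ _ k2)).
  exact/HAB_HK/prodH.
- apply: (key _ _ _ (conv_opAB (phi u) (H0 _ hv)) (ABK _ _ k1) (AK _ _ k2)).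
  exact/HAB_HK/prodH.
- have e : conv (opA (opB (phi u))) (opA (opB (phi v))) =
      opA (opB (conv (phi u) (opA (opB (phi v))))) + opA (opB (conv (opA (opB (phi u))) (phi v))) +
      opA (opH (opB (opB (conv (phi u) (phi v))))).
    rewrite (conv_opAB _ (opB0 _)) [conv (opA (opB _)) (opB _)]convC conv_opB.
    by rewrite [conv (phi v) _]convC [conv (phi u) (opB _)]convC conv_opB [conv (phi v) _]convC.
  apply: (key _ _ _ e (ABK _ _ k1) (ABK _ _ k2)).
  (* For two letters y the correction contains b twice; moved to the inner b, the factor hbar forms
     the letter hbar b. *)
  have -> c : opH (opB (opB c)) = opB (opH (opB c)).
    by apply: funext => m; rewrite /opH /opB mulr_sumr.
  exact/ABHB_HK/prodH.
Qed.

Lemma conv_phi_pos u v : wf u -> wf v -> v != [::] ->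
  inspan Hposmono (conv (phi u) (phi v)).
Proof.
move=> hu hv nv; rewrite -[conv _ _](subrK (shsum phi u v)); apply: inspanD.
  exact/K_Hpos/phi_shuffle.
apply: inspan_sum => m hm; apply: inspan_phi_pos; first exact: (wf_shR hm).
by have := size_shR hm; case: m {hm} => //; case: v nv {hv} => //= ? ? _; rewrite addnS.
Qed.

(** With x at the end of both words, all three Rota-Baxter terms have an outer [opA], which carries
    the errors of [phi_shuffle] into n. *)
Lemma phi_shuffle_x a b : wf (Lx :: a) -> wf (Lx :: b) ->
  inspan Nmono (conv (phi (Lx :: a)) (phi (Lx :: b)) - shsum phi (Lx :: a) (Lx :: b)).
Proof.
move=> ha hb; have wa := wf_behead ha; have wb := wf_behead hb.
have -> : conv (phi (Lx :: a)) (phi (Lx :: b)) - shsum phi (Lx :: a) (Lx :: b) =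
    opA (conv (phi a) (phi (Lx :: b)) - shsum phi a (Lx :: b)) +
    opA (conv (phi (Lx :: a)) (phi b) - shsum phi (Lx :: a) b) +
    opA (opH (conv (phi a) (phi b))).
  have shA u v : shsum (phi \o cons Lx) u v = opA (shsum phi u v) by rewrite /shsum opA_sum.
  rewrite shsum_cons !shA !opA_D !opA_N.
  rewrite [conv (phi (Lx :: a)) (phi (Lx :: b))](conv_opA3 (phi0 wa (wf_x ha)) (phi0 wb (wf_x hb))).
  by rewrite opprD addrAC [X in _ = X + _]addrACA.
apply: inspanD; [apply: inspanD|].
- exact/opA_KN/phi_shuffle.
- exact/opA_KN/phi_shuffle.
by apply/opA_KN/H_HposK/conv_phi_pos => //; exact: wf_x.
Qed.

End Operators.

(** * Regularization of coefficient sequences modulo n *)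

Section SeqReg.
Variable R : realType.
Local Notation C := R[i].
Variable q : C.
Hypothesis q_lt1 : `|q| < 1.
Local Notation phi := (phi q).
Local Notation opA := (opA q).
Local Notation opH := (opH q).
Local Notation inspan := (inspan q).

Lemma sgn_morph (V W : zmodType) (O : V -> W) n x : (forall x, O (- x) = - O x) ->
  O (sgn n x) = sgn n (O x).
Proof. by move=> h; rewrite /sgn; case: odd. Qed.

Lemma sgn_inspan P n c : inspan P c -> inspan P (sgn n c).
Proof. by rewrite /sgn; case: odd => // ?; exact: inspanN. Qed.

(** Induct on d. Each product with a nonempty [p.1] is expanded by [conv_opAB]: its first terms
    rebuild the formula for one y less under [opA] and [opB], and the other two kinds of terms must
    be shown to lie in n. *)
Lemma phi_reg d v : ally d -> wf (Lx :: v) ->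
  inspan Nmono (phi (d ++ Lx :: v) -
    \sum_(p <- splits d) sgn (size p.2) (conv (phi p.1) (shsum (phi \o cons Lx) v p.2))).
Proof.
move=> hd hv; have nv := wf_x hv; have wv : wf v := wf_behead hv.
have shA w : shsum (phi \o cons Lx) v w = opA (shsum phi v w) by rewrite /shsum opA_sum.
have V0 w : ally w -> shsum phi v w 0%N = 0.
  move=> hw; rewrite /shsum fct_sumE big1_seq // => m /andP[_ hm].
  apply: phi0; first exact: (wf_shR hm wv (wf_ally hw)).
  by have := size_shR hm; case: m {hm} => //; case: (v) nv.
have wy w : ally w -> wf w by exact: wf_ally.
have prodH a w : ally a -> ally w -> inspan Hmono (conv (phi a) (shsum phi v w)).
  move=> ha hw; rewrite /shsum conv_sumr; apply: inspan_sum => m hm.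
  have wm := wf_shR hm wv (wy _ hw).
  rewrite -[conv _ _](subrK (shsum phi a m)); apply: inspanD.
    exact/Hpos_H/K_Hpos/phi_shuffle/wm/wy.
  by apply: inspan_sum => m' hm'; apply: inspan_phi; exact: (wf_shR hm' (wy _ ha)).
elim: d hd => [_|y d IH hd].
  rewrite big_seq1 /sgn /= conv_delta shsum0r subrr; exact: inspan0.
have /andP[/eqP ey hd'] := hd; rewrite {}ey in hd *.
(* The middle terms of the expansions, together with the cut where [p.1] is empty. With classical
   shuffles in place of products this sum vanishes by [antipode]; so it consists of corrections
   only, and [opA] sends these into n. *)
pose S := \sum_(p <- splits (Ly :: d)) sgn (size p.2) (conv (phi p.1) (shsum phi v p.2)).
have hS : inspan Kmono S.
  rewrite -[S]subr0.
  have <- : \sum_(p <- splits (Ly :: d)) sgn (size p.2) (shsum (fun m => shsum phi p.1 m) v p.2) = 0.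
    have h0 := antipode (fun m => shsum phi v m) (isT : Ly :: d != [::]).
    rewrite -[RHS]h0; apply: eq_big_seq => p /mem_splits hp.
    have /andP[_ h2] : ally p.1 && ally p.2 by rewrite -all_cat hp.
    rewrite (rev_ally h2) [in RHS]shsumC -[in RHS]shsumA; congr sgn.
    by apply: eq_shsum => m _; exact: shsumC.
  rewrite /S -sumrB; apply: inspan_sum => p /mem_splits hp.
  have /andP[h1 h2] : ally p.1 && ally p.2 by rewrite -all_cat hp.
  rewrite -sgnB; apply: sgn_inspan.
  rewrite /shsum conv_sumr -sumrB; apply: inspan_sum => m hm.
  by apply: phi_shuffle; [done|exact: (wy _ h1)|exact: (wf_shR hm wv (wy _ h2))].
(* The third Rota-Baxter terms, each with an explicit factor hbar. *)
pose E := \sum_(p <- splits d) sgn (size p.2) (opA (opH (opB (conv (phi p.1) (shsum phi v p.2))))).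
have hE : inspan Nmono E.
  apply: inspan_sum => p /mem_splits hp; apply: sgn_inspan; apply: HAB_HN.
  have /andP[h1 h2] : ally p.1 && ally p.2 by rewrite -all_cat hp.
  exact: prodH.
pose Q := \sum_(p <- splits d) sgn (size p.2) (conv (phi p.1) (shsum (phi \o cons Lx) v p.2)).
have -> : \sum_(p <- splits (Ly :: d)) sgn (size p.2) (conv (phi p.1) (shsum (phi \o cons Lx) v p.2)) =
   opA (opB Q) + opA S + E.
  rewrite /S (splits_cons (fun a b => sgn (size b) (conv (phi a) (shsum (phi \o cons Lx) v b)))).
  rewrite (splits_cons (fun a b => sgn (size b) (conv (phi a) (shsum phi v b)))).
  rewrite opA_D conv_delta conv_delta shA [in RHS](sgn_morph _ _ (@opA_N _ q)).
  rewrite addrCA -[in RHS]addrA; congr (_ + _).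
  rewrite /Q /E opB_sum !opA_sum -!big_split; apply: eq_big_seq => p /mem_splits hp /=.
  have /andP[h1 h2] : ally p.1 && ally p.2 by rewrite -all_cat hp.
  rewrite shA (conv_opAB q_lt1 _ (V0 _ h2)) /sgn.
  by case: odd; rewrite ?opB_N ?opA_N ?opprD.
have -> : phi ((Ly :: d) ++ Lx :: v) = opA (opB (phi (d ++ Lx :: v))) by [].
rewrite !opprD !addrA -opA_N -opB_N -opA_D -opB_D; apply: inspanD; last exact: inspanN.
by apply: inspanD; [apply: AB_NN; exact: IH|apply: inspanN; exact: opA_KN].
Qed.

End SeqReg.

(** * Limits *)

Section Limits.
Variable R : realType.
Local Notation C := R[i].
Implicit Types (u v c : nat -> C) (a b : C).

Lemma cvg_to_uniq u a b : cvg_to u a -> cvg_to u b -> a = b.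
Proof.
move=> ha hb; apply/eqP; rewrite -subr_eq0 -normr_eq0; apply/negPn/negP => h.
have e0 : 0 < `|a - b| / 2 by rewrite divr_gt0 // lt_def h normr_ge0.
have [N1 h1] := ha _ e0; have [N2 h2] := hb _ e0.
have := ltrD (h1 _ (leq_maxl N1 N2)) (h2 _ (leq_maxr N1 N2)).
set x := u _; rewrite -splitr => h3.
have := le_lt_trans (ler_distD x a b) _; rewrite [`|a - x|]distrC => /(_ _ h3).
by rewrite ltxx.
Qed.

Lemma cvg_to_eq u v a : (forall M, (0 < M)%N -> u M = v M) -> cvg_to u a -> cvg_to v a.
Proof.
move=> e h eps /h [N hN]; exists N.+1 => M hM; rewrite -e; last exact: leq_ltn_trans hM.
by apply: hN; exact: ltnW.
Qed.

Lemma cvg_to_cst a : cvg_to (fun=> a) a.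
Proof. by move=> e e0; exists 0%N => M _; rewrite subrr normr0. Qed.

Lemma cvg_toD u v a b : cvg_to u a -> cvg_to v b -> cvg_to (fun M => u M + v M) (a + b).
Proof.
move=> hu hv e e0; have e2 : 0 < e / 2 by rewrite divr_gt0.
have [N1 h1] := hu _ e2; have [N2 h2] := hv _ e2.
exists (maxn N1 N2) => M; rewrite geq_max => /andP[/h1 k1 /h2 k2].
by rewrite opprD addrACA [e]splitr (le_lt_trans (ler_normD _ _)) ?ltrD.
Qed.

Lemma cvg_toZ u a b : cvg_to u a -> cvg_to (fun M => b * u M) (b * a).
Proof.
move=> hu e e0; have b1 : 0 < `|b| + 1 by rewrite ltr_wpDl.
have [N h] := hu (e / (`|b| + 1)) (divr_gt0 e0 b1).
exists N => M /h k; rewrite -mulrBr normrM.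
have : `|u M - a| * (`|b| + 1) < e by rewrite -ltr_pdivlMr.
apply: le_lt_trans; rewrite mulrC ler_wpM2l // lerDl; exact: ler01.
Qed.

Lemma cvg_toM u v a b : cvg_to u a -> cvg_to v b -> cvg_to (fun M => u M * v M) (a * b).
Proof.
move=> hu hv.
have h0 : cvg_to (fun M => (u M - a) * (v M - b)) 0.
  move=> e e0; have [N1 h1] := hu _ e0; have [N2 h2] := hv 1 ltr01.
  exists (maxn N1 N2) => M; rewrite geq_max => /andP[/h1 k1 /h2 k2].
  rewrite subr0 normrM -[e]mulr1; apply: ltr_pM => //; exact: normr_ge0.
have h1 := cvg_toD h0 (cvg_toD (cvg_toZ a hv) (cvg_toZ b hu)).
have h2 := cvg_toD h1 (cvg_to_cst (- (a * b))).
have -> : a * b = 0 + (a * b + b * a) + - (a * b) by ring.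
by apply: cvg_to_eq h2 => M _; ring.
Qed.

Lemma cvg_toN u a : cvg_to u a -> cvg_to (fun M => - u M) (- a).
Proof.
by move=> h e /h[N hN]; exists N => M /hN; rewrite -opprD normrN.
Qed.

Lemma cvg_to_sum (I : eqType) (r : seq I) (F : I -> nat -> C) (l : I -> C) :
  (forall i, i \in r -> cvg_to (F i) (l i)) ->
  cvg_to (fun M => \sum_(i <- r) F i M) (\sum_(i <- r) l i).
Proof.
elim: r => [|i r IH] h.
  by rewrite big_nil; apply: cvg_to_eq (cvg_to_cst 0) => M _; rewrite big_nil.
rewrite big_cons; apply: (@cvg_to_eq (fun M => F i M + \sum_(j <- r) F j M)).
  by move=> M _; rewrite big_cons.
apply: cvg_toD; first by apply: h; rewrite mem_head.
by apply: IH => j hj; apply: h; rewrite inE hj orbT.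
Qed.

Lemma geometric_cvg_to0 (t : R) (K : C) : 0 < t -> t < 1 ->
  forall eps : C, 0 < eps -> exists N : nat, forall M, (N <= M)%N -> `|K| * (t%:C)%C ^+ M < eps.
Proof.
move=> t0 t1 eps e0.
(* A positive element of [R[i]] is real, so the estimate can be made in R. *)
have er : (complex.Re eps)%:C%C = eps by rewrite RRe_real // realE ltW.
have kr : (complex.Re `|K|)%:C%C = `|K| by rewrite RRe_real // realE normr_ge0.
have e0' : 0 < complex.Re eps by rewrite -ltcR er.
have : (geometric (complex.Re `|K|) t @ \oo --> (0 : R))%classic.
  by apply: cvg_geometric; rewrite ger0_norm // ltW.
move/cvgrPdist_lt => /(_ _ e0')[N _ hN]; exists N => M hM.
have := hN M hM; rewrite /geometric /= sub0r normrN.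
move/(le_lt_trans (ler_norm _)); rewrite -ltcR er rmorphM rmorphXn /= kr.
exact.
Qed.

Definition csum (c : nat -> C) (a : C) : Prop := cvg_to (opB c) a.

Lemma opB_sum_Re c M : complex.Re (opB c M) = \sum_(i < M) complex.Re (c i).
Proof.
elim: M => [|M IH]; first by rewrite /opB !big_ord0.
by rewrite /opB !big_ord_recr /= -IH /opB; case: (\sum_(i < M) _) => x y; case: (c M).
Qed.

Lemma opB_sum_Im c M : complex.Im (opB c M) = \sum_(i < M) complex.Im (c i).
Proof.
elim: M => [|M IH]; first by rewrite /opB !big_ord0.
by rewrite /opB !big_ord_recr /= -IH /opB; case: (\sum_(i < M) _) => x y; case: (c M).
Qed.

Lemma real_series_cvg (x : nat -> R) (K t : R) : 0 < t -> t < 1 ->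
  (forall m, `|x m| <= K * t ^+ m) ->
  exists l : R, forall e, 0 < e -> exists N : nat, forall M, (N <= M)%N ->
    `|\sum_(i < M) x i - l| < e.
Proof.
move=> t0 t1 hx.
have K0 : 0 <= K by have := hx 0%N; rewrite mulr1; apply: le_trans.
have c1 : cvgn (series (geometric K t)).
  by apply: is_cvg_geometric_series; rewrite ger0_norm // ltW.
have c2 : cvgn [normed series x].
  apply: series_le_cvg c1 => // n; first exact: normr_ge0.
  by rewrite /geometric /= mulr_ge0 // exprn_ge0 // ltW.
have := normed_cvg c2 => /cvg_ex[l /cvgrPdist_lt hl]; exists l => e /hl [N _ hN].
exists N => M /hN /=; rewrite distrC; congr (_ < _); congr (`|_ - _|).
by rewrite /series /= big_mkord.
Qed.

Lemma csum_exists (c : nat -> C) (K t : R) : 0 < t -> t < 1 ->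
  (forall m, `|c m| <= (K%:C * t%:C ^+ m)%C) -> exists a, csum c a.
Proof.
move=> t0 t1 hc.
have hRe m : `|complex.Re (c m)| <= K * t ^+ m.
  rewrite -lecR rmorphM rmorphXn; exact: le_trans (normc_ge_Re _) (hc m).
have hIm m : `|complex.Im (c m)| <= K * t ^+ m.
  rewrite -lecR rmorphM rmorphXn; apply: le_trans (hc m).
  by rewrite normc_def lecR -sqrtr_sqr ler_wsqrtr // lerDr sqr_ge0.
have [a ha] := real_series_cvg t0 t1 hRe; have [b hb] := real_series_cvg t0 t1 hIm.
exists (a +i* b)%C => eps e0.
have er : (complex.Re eps)%:C%C = eps by rewrite RRe_real // realE ltW.
have e0' : 0 < complex.Re eps / 2 by rewrite divr_gt0 // -ltcR er.
have [N1 h1] := ha _ e0'; have [N2 h2] := hb _ e0'.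
exists (maxn N1 N2) => M; rewrite geq_max => /andP[/h1 k1 /h2 k2].
have := ltrD k1 k2; rewrite -splitr -opB_sum_Re -opB_sum_Im => k.
rewrite -ltcR er in k; apply: le_lt_trans k.
case: (opB c M) => x y /=; rewrite normc_def /= lecR.
move: (x - a) (y - b) => p r.
rewrite -[leRHS]ger0_norm ?addr_ge0 // -[leRHS]sqrtr_sqr ler_wsqrtr //.
rewrite sqrrD !real_normK ?num_real // -addrA [X in _ <= _ + X]addrC.
by rewrite lerD2l lerDl mulrn_wge0 // mulr_ge0.
Qed.

End Limits.

(** * Geometric bounds and Cauchy products *)

Section Summable.
Variable R : realType.
Local Notation C := R[i].
Variable q : C.
Hypothesis q_gt0 : 0 < `|q|.
Hypothesis q_lt1 : `|q| < 1.
Implicit Types (c d : nat -> C).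

(* [|q| < tau ^+ 2 < 1] and [sigma = tau ^+ 2 / |q|]: coefficients bounded by [sigma ^+ m] stay so
   under [opB], and [opA] turns the bound into [tau ^+ 2 ^+ m]. *)
Let tau : C := (1 + `|q|) / 2.
Let sigma : C := tau ^+ 2 / `|q|.

Definition subexp c : Prop := exists K : C, forall m, `|c m| <= K * sigma ^+ m.
Definition geom c : Prop := exists K : C, forall m, `|c m| <= K * (tau ^+ 2) ^+ m.

Lemma tau_gt0 : 0 < tau.
Proof. by rewrite divr_gt0 // addr_gt0. Qed.

Lemma tau_lt1 : tau < 1.
Proof. by rewrite ltr_pdivrMr // mul1r [X in _ < X]mulr2n ltrD2l. Qed.

Lemma tau2_gtq : `|q| < tau ^+ 2.
Proof.
rewrite -subr_gt0 (_ : _ - _ = ((1 - `|q|) / 2) ^+ 2); last by rewrite /tau; field.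
by rewrite exprn_gt0 // divr_gt0 // subr_gt0.
Qed.

Lemma sigma_gt1 : 1 < sigma.
Proof. by rewrite /sigma ltr_pdivlMr // mul1r tau2_gtq. Qed.

Lemma sigma_gt0 : 0 < sigma.
Proof. exact: lt_trans sigma_gt1. Qed.

Lemma hq_bound m : `|hq q m| <= `|1 - q| / (1 - `|q|) * `|q| ^+ m.
Proof.
have h0 : 0 <= `|1 - q| / (1 - `|q|) by rewrite divr_ge0 // subr_ge0 ltW.
case: m => [|m]; first by rewrite hq0 normr0 mulr_ge0 // exprn_ge0.
rewrite /hq /qint invf_div !normrM normrX mulrC ler_wpM2r ?exprn_ge0 //.
rewrite ler_wpM2l // normfV lef_pV2 ?posrE ?subr_gt0 ?normr_gt0 ?expq_neq1 //.
apply: le_trans (lerB_dist _ _); rewrite normr1 normrX lerD2l lerN2.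
by rewrite exprS ler_piMr // exprn_ile1 // ltW.
Qed.

Lemma subexp_delta : subexp (@delta R).
Proof.
exists 1 => m; rewrite mul1r /delta; case: m => [|m]; first by rewrite normr1.
by rewrite normr0 exprn_ge0 // ltW // sigma_gt0.
Qed.

Lemma subexp_opB c : subexp c -> subexp (opB c).
Proof.
move=> [K hK]; have s1 : 0 < sigma - 1 by rewrite subr_gt0 sigma_gt1.
have K0 : 0 <= K by have := hK 0%N; rewrite mulr1; apply: le_trans.
(* The constant solves K' + K = sigma K', which is what the step from m to m + 1 requires. *)
exists (K / (sigma - 1)); elim=> [|m IH].
  by rewrite /opB big_ord0 normr0 mulr1 divr_ge0 // ltW.
have -> : opB c m.+1 = opB c m + c m by rewrite /opB big_ord_recr.
apply: le_trans (ler_normD _ _) _; apply: le_trans (lerD IH (hK m)) _.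
rewrite exprS le_eqVlt; apply/orP; left; apply/eqP.
by field; rewrite gt_eqF.
Qed.

Lemma subexp_opA c : subexp c -> geom (opA q c).
Proof.
move=> [K hK]; exists (`|1 - q| / (1 - `|q|) * K) => m.
rewrite /opA normrM; apply: le_trans (ler_pM _ _ (hq_bound m) (hK m)) _ => //.
rewrite mulrACA -exprMn /sigma mulrCA divff ?mulr1 // gt_eqF //.
Qed.

Lemma geom_subexp c : geom c -> subexp c.
Proof.
move=> [K hK]; exists K => m; apply: le_trans (hK m) _.
have K0 : 0 <= K by have := hK 0%N; rewrite mulr1; apply: le_trans.
rewrite ler_wpM2l // (@le_trans _ _ 1) //.
  by rewrite exprn_ile1 // ?exprn_ge0 ?exprn_ile1 // ltW // ?tau_gt0 ?tau_lt1.
by rewrite exprn_ege1 // ltW // sigma_gt1.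
Qed.

Lemma subexp_phi u : subexp (phi q u).
Proof.
elim: u => [|[] u IH] /=; first exact: subexp_delta.
  exact/geom_subexp/subexp_opA.
exact/geom_subexp/subexp_opA/subexp_opB.
Qed.

Lemma geom_delta : geom (@delta R).
Proof.
exists 1 => m; rewrite mul1r /delta; case: m => [|m]; first by rewrite normr1.
by rewrite normr0 !exprn_ge0 // ltW // tau_gt0.
Qed.

Lemma geom_phi u : geom (phi q u).
Proof.
case: u => [|[] u] /=; first exact: geom_delta.
  exact/subexp_opA/subexp_phi.
exact/subexp_opA/subexp_opB/subexp_phi.
Qed.

Lemma complex_pos (x : C) : 0 <= x -> (complex.Re x)%:C%C = x.
Proof. by move=> x0; rewrite RRe_real // realE x0. Qed.

Lemma geom_csum c : geom c -> exists a, csum c a.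
Proof.
move=> [K hK].
have K0 : 0 <= K by have := hK 0%N; rewrite mulr1; apply: le_trans.
have t0 : 0 < tau ^+ 2 by rewrite exprn_gt0 // tau_gt0.
have t1 : tau ^+ 2 < 1 by rewrite exprn_ilt1 // ?ltW ?tau_gt0 // tau_lt1.
apply: (@csum_exists _ c (complex.Re K) (complex.Re (tau ^+ 2))).
- by rewrite -ltcR complex_pos // ltW.
- by rewrite -ltcR complex_pos // ltW.
by move=> m; rewrite !complex_pos // ltW.
Qed.

Lemma geom_tail d : geom d -> exists2 K, 0 <= K &
  forall N M, (N <= M)%N -> `|opB d M - opB d N| <= K * tau ^+ N.
Proof.
move=> [K hK].
have K0 : 0 <= K by have := hK 0%N; rewrite mulr1; apply: le_trans.
have t1 : 0 < 1 - tau by rewrite subr_gt0 tau_lt1.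
have h N M : `|opB d (N + M) - opB d N| <= K / (1 - tau) * (tau ^+ N - tau ^+ (N + M)).
  elim: M => [|M IH]; first by rewrite addn0 !subrr normr0 mulr0.
  have -> : opB d (N + M.+1) = opB d (N + M) + d (N + M)%N by rewrite addnS /opB big_ord_recr.
  rewrite addrAC; apply: le_trans (ler_normD _ _) _; apply: le_trans (lerD IH (hK _)) _.
  apply: (@le_trans _ _ (K / (1 - tau) * (tau ^+ N - tau ^+ (N + M)) + K * tau ^+ (N + M))).
    rewrite lerD2l ler_wpM2l // -exprM mulnC exprM expr2.
    by rewrite ler_piMr // ?exprn_ile1 // ?exprn_ge0 // ltW // ?tau_gt0 ?tau_lt1.
  rewrite addnS exprS le_eqVlt; apply/orP; left; apply/eqP.
  by field; rewrite gt_eqF.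
exists (K / (1 - tau)); first by rewrite divr_ge0 // ltW.
move=> N M /subnKC <-; apply: le_trans (h _ _) _.
apply: ler_wpM2l; first by rewrite divr_ge0 // ltW.
by rewrite gerBl exprn_ge0 // ltW // tau_gt0.
Qed.

(** The partial sum of the Cauchy product differs from the product of partial sums by [D M]. There
    |c_i| <= K tau^(2i) meets a tail bounded by K' tau^(M-i), giving K K' tau^M tau^i. The surplus
    tau^i keeps the sum over i bounded; this is why coefficients are measured against tau^2 and
    tails against tau. *)
Lemma csum_conv c d a b : geom c -> geom d -> csum c a -> csum d b ->
  csum (conv c d) (a * b).
Proof.
move=> hc hd ha hb.
have [K hK] := hc; have [K' K'0 hK'] := geom_tail hd.
have K0 : 0 <= K by have := hK 0%N; rewrite mulr1; apply: le_trans.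
have t0 := tau_gt0; have t1 : 0 < 1 - tau by rewrite subr_gt0 tau_lt1.
pose D M := \sum_(i < M) c i * (opB d M - opB d (M - i)%N).
have eD M : opB (conv c d) M = opB c M * opB d M - D M.
  rewrite convC -conv_opB convC /conv big_ord_recr /= subnn.
  rewrite {2}/opB big_ord0 mulr0 addr0 /D {2}/opB mulr_suml -sumrB.
  by apply: eq_bigr => i _; rewrite mulrBr opprB addrC subrK.
have bD M : `|D M| <= K * K' / (1 - tau) * tau ^+ M.
  apply: le_trans (ler_norm_sum _ _ _) _.
  apply: (@le_trans _ _ (\sum_(i < M) K * K' * tau ^+ M * tau ^+ i)).
    apply: ler_sum => i _; rewrite normrM.
    have hi : (i <= M)%N by apply: ltnW.
    apply: le_trans (ler_pM _ _ (hK i) (hK' _ _ (leq_subr i M))) _ => //.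
    have -> : tau ^+ M = tau ^+ (M - i) * tau ^+ i by rewrite -exprD subnK.
    rewrite -exprM mul2n -addnn exprD.
    by rewrite le_eqVlt; apply/orP; left; apply/eqP; ring.
  rewrite -mulr_sumr [leRHS]mulrAC.
  apply: ler_wpM2l; first by rewrite !mulr_ge0 // exprn_ge0 // ltW.
  rewrite -[leRHS]mul1r ler_pdivlMr // mulrC.
  have -> : (1 - tau) * \sum_(i < M) tau ^+ i = 1 - tau ^+ M.
    by apply: oppr_inj; rewrite opprB subrX1 -mulNr opprB.
  by rewrite gerBl exprn_ge0 // ltW.
have cD : cvg_to D 0.
  move=> e e0.
  have tr : (complex.Re tau)%:C%C = tau by rewrite complex_pos // ltW.
  have r0 : 0 < complex.Re tau by rewrite -ltcR tr.
  have r1 : complex.Re tau < 1 by rewrite -ltcR tr tau_lt1.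
  have [N hN] := geometric_cvg_to0 (K * K' / (1 - tau)) r0 r1 e0.
  exists N => M /hN; rewrite tr subr0 ger0_norm; last by rewrite divr_ge0 ?mulr_ge0 // ltW.
  exact: le_lt_trans.
have := cvg_toD (cvg_toM ha hb) (cvg_toN cD); rewrite oppr0 addr0.
by apply: cvg_to_eq => M _; rewrite eD.
Qed.

End Summable.

(** * The q-stuffle product and the ideal n *)

Definition option_of_Alet (u : Alet) : option nat := if u is G k then Some k else None.
Definition Alet_of_option (o : option nat) : Alet := if o is Some k then G k else Hb.
Lemma option_of_AletK : cancel option_of_Alet Alet_of_option. Proof. by case. Qed.
HB.instance Definition _ := Equality.copy Alet (can_type option_of_AletK).

Lemma starR_cons u x v y : starR (u :: x) (v :: y) =
  fs_map_word (cons u) (starR x (v :: y)) ++ fs_map_word (cons v) (starR (u :: x) y)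
  ++ fs_shift (circ u v).1 (fs_map_word (cons (circ u v).2) (starR x y)).
Proof. by []. Qed.

Lemma starR_ind (P : seq Alet -> seq Alet -> nat -> seq Alet -> Prop) :
  (forall v, P [::] v 0 v) -> (forall u, P u [::] 0 u) ->
  (forall u x v y e w, P x (v :: y) e w -> P (u :: x) (v :: y) e (u :: w)) ->
  (forall u x v y e w, P (u :: x) y e w -> P (u :: x) (v :: y) e (v :: w)) ->
  (forall u x v y e w, P x y e w ->
     P (u :: x) (v :: y) (e + (circ u v).1)%N ((circ u v).2 :: w)) ->
  forall x y t, t \in starR x y -> P x y t.1.2 t.2.
Proof.
move=> h1 h2 h3 h4 h5; elim=> [|u x IHx] y; first by move=> t; rewrite inE => /eqP ->.
elim: y => [|v y IHy] t; first by rewrite inE => /eqP ->.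
rewrite starR_cons !mem_cat => /orP[/mapP[r hr ->]|/orP[/mapP[r hr ->]|]].
- by apply: h3; exact: (IHx _ _ hr).
- by apply: h4; exact: (IHy _ hr).
by move=> /mapP[s /mapP[r hr ->] ->]; apply: h5; exact: (IHx _ _ hr).
Qed.

Lemma circ_valid u v : Alet_valid u -> Alet_valid v -> Alet_valid (circ u v).2.
Proof. by case: u v => [|k] [|l] //= hk hl; rewrite addn_gt0 hk. Qed.

Lemma starR_valid x y t : t \in starR x y -> Aword_valid x -> Aword_valid y -> Aword_valid t.2.
Proof.
move: x y t; apply: (starR_ind (P := fun x y e w => Aword_valid x -> Aword_valid y -> Aword_valid w)) => //.
- by move=> u x v y e w IH /= /andP[hu hx] hy; rewrite hu IH.
- by move=> u x v y e w IH hx /= /andP[hv hy]; rewrite hv IH.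
by move=> u x v y e w IH /= /andP[hu hx] /andP[hv hy]; rewrite circ_valid // IH.
Qed.

Lemma starR_hat x y t : t \in starR x y -> hat x -> hat y -> hat t.2.
Proof.
move=> ht /andP[vx hx] /andP[vy hy]; rewrite /hat (starR_valid ht) //=.
move: ht hx hy {vx vy}; move: x y t.
have h x y t : t \in starR x y -> headG x -> headG y -> headG t.2.
  move: x y t; apply: (starR_ind (P := fun x y e w => headG x -> headG y -> headG w)) => //.
  by move=> [|k] x [|l] y e w.
exact: h.
Qed.

(** Interleaving letters keeps the pattern of n_0, merging g_k with g_l only raises the exponent,
    and any merge that uses up hbar b produces a power of hbar. The statement on [hashb] is needed
    to carry the induction past the letter g_k. *)
Lemma starR_n0 x y t : t \in starR x y -> n0r x -> (0 < t.1.2)%N || n0r t.2.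
Proof.
move=> ht; suff h : (hashb x -> (0 < t.1.2)%N || hashb t.2) /\ (n0r x -> (0 < t.1.2)%N || n0r t.2) by case: h.
move: x y t ht; apply: (starR_ind (P := fun x y e w =>
  (hashb x -> (0 < e)%N || hashb w) /\ (n0r x -> (0 < e)%N || n0r w))) => //.
- move=> u x v y e w [IH1 IH2]; split; case: u => [|k] //=; first by rewrite orbT.
  move=> /orP[/andP[-> /IH1 /orP[->//|->]]|/IH2 /orP[->//|->]]; rewrite ?orbT //.
- move=> u x v y e w [IH1 IH2]; split=> h.
    by have /orP[->//|/= ->] := IH1 h; rewrite !orbT.
  by have /orP[->//|h2] := IH2 h; case: v => [|l] /=; rewrite h2 !orbT.
move=> u x v y e w [IH1 IH2]; case: u v => [|k] [|l] /=; rewrite ?addn1 ?addn0 //; split=> //.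
move=> /orP[/andP[k1 /IH1 /orP[->//|h]]|/IH2 /orP[->//|->]]; rewrite ?orbT //.
by rewrite h (leq_trans k1 (leq_addr _ _)) orbT.
Qed.

Lemma n0_genP ab (l := rev ab) :
  [/\ Aword_valid (rev (n0_gen ab)), hat (rev (n0_gen ab)),
      hashb (rev (n0_gen ab)) = has (fun p => 0 < p.1)%N l &
      n0_cond ab <-> n0r (rev (n0_gen ab))].
Proof.
rewrite {}/l; elim/last_ind: ab => [|ab p [IH1 IH2 IH3 IH4]].
  by split=> //; split=> // -[].
have -> : rev (n0_gen (rcons ab p)) = G p.2.+1 :: nseq p.1 Hb ++ rev (n0_gen ab).
  by rewrite /n0_gen map_rcons flatten_rcons rev_cat rev_rcons rev_nseq.
have hv : Aword_valid (nseq p.1 Hb ++ rev (n0_gen ab)).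
  by rewrite /Aword_valid all_cat all_nseq orbT; exact: IH1.
have hb : hashb (nseq p.1 Hb ++ rev (n0_gen ab)) = has (fun p => 0 < p.1)%N (rev (rcons ab p)).
  by rewrite /hashb has_cat rev_rcons /= -[X in _ || X]/(hashb _) IH3 has_nseq /= andbT.
have n0 : n0r (nseq p.1 Hb ++ rev (n0_gen ab)) = n0r (rev (n0_gen ab)) by elim: p.1.
split=> //; first by rewrite /hat /= andbT.
rewrite /= hb n0 ltnS; split.
  move=> [_ [s [t [st [ht [hs1 ht2]]]]]].
  move: ht; rewrite size_rcons ltnS leq_eqVlt => /orP[/eqP e|ht].
    apply/orP; left; move: ht2; rewrite nth_rcons e ltnn eqxx => -> /=.
    rewrite has_rev; apply/(has_nthP (0, 0)%N); exists s => //.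
    by rewrite size_rcons ltnS -e.
  apply/orP; right; apply/IH4; split; first exact: leq_ltn_trans ht.
  exists s, t; split=> //; split=> //.
  by move: hs1 ht2; rewrite !nth_rcons ht (leq_ltn_trans st ht).
case/orP.
  rewrite has_rev => /andP[p2 /(has_nthP (0, 0)%N) [s]]; rewrite size_rcons ltnS => hs hs1.
  split; first by rewrite size_rcons.
  by exists s, (size ab); rewrite size_rcons [nth _ _ (size ab)]nth_rcons ltnn eqxx.
move/IH4 => [_ [s [t [st [ht [hs1 ht2]]]]]]; split; first by rewrite size_rcons.
exists s, t; rewrite size_rcons !nth_rcons ht (leq_ltn_trans st ht).
by split=> //; split=> //; exact: ltnW.
Qed.

(** One block (hbar b)^alpha g_(beta+1) is removed at a time; since the word ends in some g_k, no
    hbar b is left over. *)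
Lemma hat_n0_gen w : hat w -> exists ab, w = rev (n0_gen ab).
Proof.
have [n] := ubnP (size w); elim: n w => // n IH [|[|k] w] //=.
- by exists [::].
- by move=> _ /andP[].
rewrite ltnS => hs /andP[/= /andP[k0 hw] _].
have [al [w' [ew hw']]] : exists al w', w = nseq al Hb ++ w' /\ hat w'.
  elim: w hw {hs} => [|[|l] w IHw] /= hw; first by exists 0%N, [::].
    by have [al [w' [-> h]]] := IHw hw; exists al.+1, w'.
  by exists 0%N, (G l :: w); rewrite /hat /= hw.
have [|ab e] := IH w' _ hw'.
  by apply: leq_ltn_trans hs; rewrite ew size_cat leq_addl.
exists (rcons ab (al, k.-1)).
by rewrite /n0_gen map_rcons flatten_rcons rev_cat rev_rcons rev_nseq /= prednK // ew e.
Qed.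

Lemma hatE w : hatH0_word (rev w) = hat w.
Proof.
rewrite /hatH0_word /hat /Aword_valid all_rev; case hv : (all _ w) => //=.
case: w hv => [//|u w] /= /andP[hu _]; rewrite rev_cons.
case e : (rcons (rev w) u) (size_rcons (rev w) u) => [//|a l] _.
by rewrite -e last_rcons; case: u hu {e}.
Qed.

Lemma n_monoP e w : n_mono e (rev w) <-> Nmono e w.
Proof.
rewrite /n_mono /Nmono hatE; split.
  case=> [[ab [hab ew]]|[-> ->] //].
  have [_ h1 _ h2] := n0_genP ab; rewrite -[w]revK ew h1 /=.
  by apply/orP; right; apply/h2.
move=> /andP[hw /orP[e0|hn]]; [by right|left].
have [ab ew] := hat_n0_gen hw; exists ab; rewrite ew revK; split=> //.
by have [_ _ _ h2] := n0_genP ab; apply/h2; rewrite -ew.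
Qed.

Lemma in_spanP (P : nat -> seq Alet -> Prop) X :
  in_span P X <-> (forall t, t \in X -> P t.1.2 t.2).
Proof.
elim: X => [|t X IH] /=; first by split.
rewrite IH; split=> [[h1 h2] r|h].
  by rewrite inE => /predU1P[->|/h2].
by split=> [|r hr]; apply: h; rewrite inE ?eqxx // hr orbT.
Qed.

(** * Truncated sums: the q-stuffle product and the symmetric values *)

Section StarHom.
Variable R : realType.
Local Notation C := R[i].
Variable q : C.
Hypothesis q_lt1 : `|q| < 1.

Lemma Fq_circ m u v : Fq q m u * Fq q m v = (1 - q) ^+ (circ u v).1 * Fq q m (circ u v).2.
Proof.
case: u v => [|k] [|l] //=; rewrite ?expr0 ?expr1 ?mul1r //; first by rewrite mulrC.
by rewrite mulnDl !exprD invfM mulrACA.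
Qed.

Definition svM (X : fs) (M : nat) : C :=
  \sum_(t <- X) ratr t.1.1 * (1 - q) ^+ t.1.2 * ZqMrev q t.2 M.

Lemma svM_cat X Y M : svM (X ++ Y) M = svM X M + svM Y M.
Proof. exact: big_cat. Qed.

Lemma svM_shift e X M : svM (fs_shift e X) M = (1 - q) ^+ e * svM X M.
Proof.
rewrite /svM big_map mulr_sumr; apply: eq_bigr => t _ /=.
by rewrite exprD; ring.
Qed.

Lemma ZqMrev_S u w M : ZqMrev q (u :: w) M.+2 = ZqMrev q (u :: w) M.+1 + ZqMrev q w M.+1 * Fq q M.+1 u.
Proof. by rewrite /= big_nat_recr. Qed.

Lemma ZqMrev_1 u w : ZqMrev q (u :: w) 1 = 0.
Proof. by rewrite /= big_geq. Qed.

Local Arguments ZqMrev : simpl never.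

Lemma svM_consS u X M : svM (fs_map_word (cons u) X) M.+2 =
  svM (fs_map_word (cons u) X) M.+1 + Fq q M.+1 u * svM X M.+1.
Proof.
rewrite /svM !big_map mulr_sumr -big_split; apply: eq_bigr => t _.
by rewrite /= ZqMrev_S; ring.
Qed.

Lemma svM_cons1 u X : svM (fs_map_word (cons u) X) 1 = 0.
Proof. by rewrite /svM big_map big1 // => t _; rewrite ZqMrev_1 mulr0. Qed.

(** Induction on the truncation. The new value of the largest variable turns the product into (A +
    a)(B + b); the term ab is the one that [circ] encodes, by [Fq_circ]. *)
Lemma svM_starR M x y : svM (starR x y) M.+1 = ZqMrev q x M.+1 * ZqMrev q y M.+1.
Proof.
elim: M x y => [|M IH] [|u x] y; rewrite ?[starR [::] y]/= /svM ?big_seq1 ?rmorph1 ?mul1r //.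
  case: y => [|v y]; first by rewrite big_seq1 rmorph1 !mul1r mulr1.
  by rewrite -/(svM _ _) starR_cons !svM_cat svM_shift !svM_cons1 mulr0 !addr0 !ZqMrev_1 mul0r.
case: y => [|v y]; first by rewrite big_seq1 rmorph1 !mul1r mulr1.
have e := IH (u :: x) (v :: y); rewrite starR_cons !svM_cat svM_shift in e.
rewrite -/(svM _ _) starR_cons !svM_cat svM_shift !svM_consS !IH !ZqMrev_S.
transitivity (ZqMrev q (u :: x) M.+1 * ZqMrev q (v :: y) M.+1 +
  Fq q M.+1 u * (ZqMrev q x M.+1 * ZqMrev q (v :: y) M.+1) +
  Fq q M.+1 v * (ZqMrev q (u :: x) M.+1 * ZqMrev q y M.+1) +
  (Fq q M.+1 u * Fq q M.+1 v) * (ZqMrev q x M.+1 * ZqMrev q y M.+1)); last by ring.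
by rewrite Fq_circ -e; ring.
Qed.

Lemma ZqM_star_word w w' M : (0 < M)%N ->
  ZqM q (star_word w w') M = ZqM_word q w M * ZqM_word q w' M.
Proof.
case: M => // M _; rewrite /ZqM_word -svM_starR /svM /ZqM /star_word big_map.
by apply: eq_bigr => t _; rewrite /ZqM_word revK.
Qed.

Lemma ZqM_star X Y M : (0 < M)%N -> ZqM q (star_fs X Y) M = ZqM q X M * ZqM q Y M.
Proof.
move=> M0; rewrite {1}/ZqM /star_fs big_flatten big_allpairs_dep /=.
rewrite mulr_suml; apply: eq_bigr => s _; rewrite mulr_sumr; apply: eq_bigr => t _.
rewrite big_map mulrACA -mulrA -ZqM_star_word // /ZqM !mulr_sumr; apply: eq_bigr => r _ /=.
by rewrite !exprD !rmorphM; ring.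
Qed.

Lemma ZqM_word1 w M : ZqM q [:: (1%Q, 0%N, w)] M = ZqM_word q w M.
Proof. by rewrite /ZqM big_seq1 rmorph1 !mul1r. Qed.

(** Decreasing order of m, because the first letter of a reversed word carries the largest
    variable. *)
Definition pts (M : nat) : seq C := [seq hq q m | m <- rev (iota 1 M.-1)].

Lemma ptsS M : pts M.+2 = hq q M.+1 :: pts M.+1.
Proof. by rewrite /pts -[M.+2.-1]addn1 iotaD rev_cat. Qed.

Lemma ZqMrev_nsum z M : (0 < M)%N -> ZqMrev q (map G z) M = nsum z (pts M).
Proof.
case: M => // M _; elim: M z => [|M IH] [|u z]; rewrite ?nsum_nil //.
  exact: ZqMrev_1.
rewrite ptsS /= ZqMrev_S -[G u :: map G z]/(map G (u :: z)) !IH /=.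
by congr (_ + _); rewrite mulrC /hq [in RHS]exprMn exprVn -exprM mulnC.
Qed.

(* The points -1, ..., -(M-1), M-1, ..., 1, where [hq] is extended to be odd: the truncated
   symmetric sums are the nested sums over this decreasing chain. *)
Definition spts (M : nat) : seq C := rev (map -%R (pts M)) ++ pts M.

Lemma ZSqM_sum k M : (0 < M)%N -> ZSqM q k M =
  \sum_(p <- splits k) (-1) ^+ wt p.2 * (nsum (rev p.1) (pts M) * nsum p.2 (pts M)).
Proof.
move=> M0; rewrite /ZSqM /wS_word /ZqM big_flatten big_map.
rewrite (splits_index (fun a b => (-1) ^+ wt b * (nsum (rev a) (pts M) * nsum b (pts M)))).
rewrite /gword size_map; apply: eq_bigr => i _.
rewrite -/(ZqM _ _ _) ZqM_star // ZqM_word1 /ZqM big_seq1 /= /ZqM_word revK.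
rewrite -map_take -map_drop -map_rev !ZqMrev_nsum // expr0 mulr1.
rewrite big_map (_ : ratr _ = (-1) ^+ wt (drop i k)); first by rewrite mulrCA.
rewrite /psi_letter_sign; elim: (drop i k) => [|n l IH]; first by rewrite big_nil rmorph1.
by rewrite big_cons rmorphM [X in _ * X]IH rmorphXn rmorphN1 -exprD.
Qed.

Lemma ZSqM_nsum k M : (0 < M)%N -> ZSqM q k M = nsum (rev k) (spts M).
Proof.
move=> M0; rewrite ZSqM_sum // nsum_cat.
rewrite (splits_rev (fun a b => nsum a (rev (map -%R (pts M))) * nsum b (pts M))).
by apply: eq_bigr => p _; rewrite nsum_rev nsum_opp -mulrA [X in _ = _ * X]mulrC.
Qed.

Lemma ZSqM_harm k l M : (0 < M)%N ->
  \sum_(m <- harm k l) ZSqM q m M = ZSqM q k M * ZSqM q l M.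
Proof.
move=> M0; rewrite /harm big_map !ZSqM_nsum // -nsum_harmR.
by apply: eq_bigr => m _; rewrite ZSqM_nsum // revK.
Qed.

End StarHom.

(** * Indices and their words *)

Lemma harmR_ind (P : seq nat -> seq nat -> seq nat -> Prop) :
  (forall v, P [::] v v) -> (forall u, P u [::] u) ->
  (forall u x v y w, P x (v :: y) w -> P (u :: x) (v :: y) (u :: w)) ->
  (forall u x v y w, P (u :: x) y w -> P (u :: x) (v :: y) (v :: w)) ->
  (forall u x v y w, P x y w -> P (u :: x) (v :: y) ((u + v)%N :: w)) ->
  forall x y t, t \in harmR x y -> P x y t.
Proof.
move=> h1 h2 h3 h4 h5; elim=> [|u x IHx] y; first by move=> t; rewrite inE => /eqP ->.
elim: y => [|v y IHy] t; first by rewrite inE => /eqP ->.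
rewrite harmR_cons !mem_cat => /orP[/mapP[r hr ->]|/orP[/mapP[r hr ->]|/mapP[r hr ->]]].
- by apply: h3; exact: IHx.
- by apply: h4; exact: IHy.
by apply: h5; exact: IHx.
Qed.

Lemma harm_pos k l m : m \in harm k l -> index_pos k -> index_pos l -> index_pos m.
Proof.
rewrite /index_pos => /mapP[r hr ->]; rewrite all_rev -(all_rev _ k) -(all_rev _ l).
move: (rev k) (rev l) r hr; apply: (harmR_ind (P := fun x y w => index_pos x -> index_pos y -> index_pos w)) => //.
- by move=> u x v y w IH /= /andP[hu hx] hy; rewrite hu IH.
- by move=> u x v y w IH hx /= /andP[hv hy]; rewrite hv IH.
by move=> u x v y w IH /= /andP[hu hx] /andP[hv hy]; rewrite addn_gt0 hu IH.
Qed.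

Lemma admissible_rev k : admissible (rev k) = (if k is u :: _ then (1 < u)%N else true).
Proof.
case: k => [//|u k]; rewrite rev_cons /admissible.
by case e : (rcons (rev k) u) (size_rcons (rev k) u) => [//|a l] _; rewrite -e last_rcons.
Qed.

Lemma harm_admissible k l m : m \in harm k l -> admissible k -> admissible l -> admissible m.
Proof.
move=> /mapP[r hr ->]; rewrite -[k]revK -[l]revK !admissible_rev.
pose hd k := if k is u :: _ then (1 < u)%N else true.
move: (rev k) (rev l) r hr; apply: (harmR_ind (P := fun x y w => hd x -> hd y -> hd w)) => //.
by move=> u x v y w _ hu hv; exact: leq_trans hu (leq_addr _ _).
Qed.

Lemma zword_rcons k n : zword (rcons k n) = zword k ++ Ly :: nseq n.-1 Lx.
Proof. by rewrite /zword map_rcons flatten_rcons. Qed.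

Lemma wf_rev_zword k : wf (rev (zword k)).
Proof. by case: k => // n k; rewrite /= /wf rev_cons last_rcons. Qed.

Lemma size_zword k : index_pos k -> size (zword k) = wt k.
Proof.
elim: k => //= n k IH /andP[n0 /IH <-].
by rewrite size_cat size_nseq -addSn prednK.
Qed.

(** [decode] leaves leading x's in its discarded counter; [wf] ensures that there are none. *)
Lemma zword_decode w : wf (rev w) -> zword (decode w) = w /\ index_pos (decode w).
Proof.
pose st := foldr (fun u (st : nat * seq nat) =>
            match u with
            | Lx => (st.1.+1, st.2)
            | Ly => (0%N, st.1.+1 :: st.2)
            end) (0%N, [::]).
have h v : v = nseq (st v).1 Lx ++ zword (st v).2 /\ index_pos (st v).2.
  by elim: v => [//|[] v [e hp]] /=; rewrite {1}e.
have [e hp] := h w => hw; split=> //; rewrite /decode -/(st w) [RHS]e.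
case e1 : (st w).1 e => [//|n] /= e; move: hw; rewrite e rev_cons.
by rewrite /wf last_rcons.
Qed.

Lemma admissible_decode m : wf (Lx :: m) -> admissible (decode (rev (Lx :: m))).
Proof.
move=> hm; have [|] := @zword_decode (rev (Lx :: m)); first by rewrite revK.
case/lastP: (decode _) => [|k n] // e; rewrite /index_pos all_rcons => /andP[n0 _].
rewrite -[rcons k n]revK admissible_rev rev_rcons; case: n n0 e => [//|[|n]] // _.
by rewrite zword_rcons rev_cons /= cats1 => /rcons_inj[].
Qed.

(** With the adjoined letter, a word of depth r has r + 1 letters y, one for each cut of the index.
    The proof carries along the prefix [v] already read. *)
Lemma symsum_zword (V : nmodType) (g : seq xy -> seq xy -> V) k :
  \sum_(p <- splits (Ly :: rev (zword k))) atY (fun u => g p.1 u) p.2 =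
  \sum_(p <- splits k) g (zword (rev p.2)) (rev (zword p.1)).
Proof.
suff h v : \sum_(p <- splits (Ly :: rev (zword k))) atY (fun u => g (v ++ p.1) u) p.2 =
  \sum_(p <- splits k) g (v ++ zword (rev p.2)) (rev (zword p.1)) by exact: (h [::]).
elim/last_ind: k v => [|k n IH] v; first by rewrite /= !big_cons !big_nil /= !addr0.
rewrite (splits_rcons (fun a b => g (v ++ zword (rev b)) (rev (zword a)))) addrC.
rewrite (splits_cons (fun a b => atY (fun u => g (v ++ a) u) b)) /=; congr (_ + _).
rewrite zword_rcons rev_cat rev_cons rev_nseq cat_rcons.
have hx m w v' : \sum_(p <- splits (nseq m Lx ++ Ly :: w)) atY (fun u => g (v' ++ p.1) u) p.2 =
   \sum_(p <- splits (Ly :: w)) atY (fun u => g ((v' ++ nseq m Lx) ++ p.1) u) p.2.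
  elim: m v' => [|m IHm] v'; first by rewrite cats0.
  rewrite [nseq m.+1 Lx ++ _]/= (splits_cons (fun a b => atY (fun u => g (v' ++ a) u) b)) /= add0r.
  rewrite -[v' ++ _ :: _]cat_rcons -IHm; apply: eq_bigr => p _.
  by case: p.2 => [|[] s] //=; rewrite cat_rcons.
have := hx n.-1 (rev (zword k)) (rcons v Ly); rewrite IH => e.
transitivity (\sum_(p <- splits (nseq n.-1 Lx ++ Ly :: rev (zword k)))
    atY (fun u => g (rcons v Ly ++ p.1) u) p.2).
  by apply: eq_bigr => p _; case: p.2 => [|[] s] //=; rewrite cat_rcons.
rewrite e; apply: eq_bigr => p _; congr (g _ _).
by rewrite cat_rcons rev_rcons -catA.
Qed.

Lemma sgn_expr (K : comNzRingType) n (z : K) : sgn n z = (-1) ^+ n * z.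
Proof. by rewrite /sgn -signr_odd; case: odd; rewrite ?mulN1r ?mul1r. Qed.

(** * Values *)

Section Values.
Variable R : realType.
Local Notation C := R[i].
Variable q : C.
Hypothesis q_gt0 : 0 < `|q|.
Hypothesis q_lt1 : `|q| < 1.
Local Notation phi := (phi q).
Local Notation inspan := (inspan q).

Lemma csumD c d a b : csum c a -> csum d b -> csum (c + d : nat -> C) (a + b).
Proof. by move=> h1 h2; rewrite /csum opB_D; exact: cvg_toD. Qed.

Lemma csumN c a : csum c a -> csum (- c : nat -> C) (- a).
Proof. by move=> h; rewrite /csum opB_N; exact: cvg_toN. Qed.

Lemma csum_sum (I : eqType) (r : seq I) (F : I -> nat -> C) (l : I -> C) :
  (forall i, i \in r -> csum (F i) (l i)) -> csum (\sum_(i <- r) F i) (\sum_(i <- r) l i).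
Proof.
move=> h; rewrite /csum opB_sum; apply: cvg_to_eq (cvg_to_sum h) => M _.
by rewrite fct_sumE.
Qed.

Lemma csum_sgn n c a : csum c a -> csum (sgn n c : nat -> C) (sgn n a).
Proof. by rewrite /sgn; case: odd => // ?; exact: csumN. Qed.

(** The bound [geom_phi] holds for every word, so the value is defined even where the word encodes
    no index. *)
Definition fval (u : seq xy) : C := sval (cid (geom_csum q_gt0 q_lt1 (geom_phi q_gt0 q_lt1 u))).

Lemma fvalP u : csum (phi u) (fval u).
Proof. by rewrite /fval; case: cid. Qed.

Lemma fval_nil : fval [::] = 1.
Proof.
apply: (cvg_to_uniq (fvalP [::])); apply: cvg_to_eq (cvg_to_cst 1) => -[//|M] _.
by rewrite /opB big_ord_recl big1 ?addr0.
Qed.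

Lemma Zq_is_inspan P c z : inspan P c -> csum c z ->
  exists2 X, (forall t, t \in X -> P t.1.2 (rev t.2)) & Zq_is q X z.
Proof.
move=> [X /allP hX ->] h; exists [seq (t.1.1, t.1.2, rev t.2) | t <- X].
  by move=> t /mapP[r /hX hr ->]; rewrite revK.
apply: cvg_to_eq h => M M0; rewrite /opB /sv /ZqM big_map exchange_big /=.
by apply: eq_bigr => t _; rewrite -mulr_sumr /ZqM_word revK ZqMrev_cw.
Qed.

Lemma ZqM_cat X Y M : ZqM q (X ++ Y) M = ZqM q X M + ZqM q Y M.
Proof. exact: big_cat. Qed.

Definition fs_opp (X : fs) : fs := [seq (- t.1.1, t.1.2, t.2) | t <- X].

Lemma ZqM_opp X M : ZqM q (fs_opp X) M = - ZqM q X M.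
Proof.
rewrite /ZqM big_map -sumrN; apply: eq_bigr => t _ /=.
by rewrite rmorphN !mulNr.
Qed.

Lemma Nq0 : Nq_set q 0.
Proof. by exists [::]; split=> //; apply: cvg_to_eq (cvg_to_cst 0) => M _; rewrite /ZqM big_nil. Qed.

Lemma NqD a b : Nq_set q a -> Nq_set q b -> Nq_set q (a + b).
Proof.
move=> [X [/in_spanP hX zX]] [Y [/in_spanP hY zY]]; exists (X ++ Y); split.
  by apply/in_spanP => t; rewrite mem_cat => /orP[/hX|/hY].
by apply: cvg_to_eq (cvg_toD zX zY) => M _; rewrite ZqM_cat.
Qed.

Lemma NqN a : Nq_set q a -> Nq_set q (- a).
Proof.
move=> [X [/in_spanP hX zX]]; exists (fs_opp X); split.
  by apply/in_spanP => t /mapP[r /hX hr ->].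
by apply: cvg_to_eq (cvg_toN zX) => M _; rewrite ZqM_opp.
Qed.

Lemma Nq_inspan c z : inspan Nmono c -> csum c z -> Nq_set q z.
Proof.
move=> hc hz; have [X hX zX] := Zq_is_inspan hc hz; exists X; split=> //.
by apply/in_spanP => t /hX h; rewrite -[t.2]revK; apply/n_monoP.
Qed.

Lemma ZqM_gword k M : (0 < M)%N -> index_pos k ->
  ZqM q [:: (1%Q, 0%N, gword k)] M = opB (phi (rev (zword k))) M.
Proof. by move=> M0 hk; rewrite ZqM_word1 /ZqM_word ZqMrev_cw // phi_rev_zword. Qed.

Definition fidx (k : seq nat) : C := fval (rev (zword k)).

Lemma Zq_is_fidx k : index_pos k -> Zq_is q [:: (1%Q, 0%N, gword k)] (fidx k).
Proof. by move=> hk; apply: cvg_to_eq (fvalP _) => M M0; rewrite ZqM_gword. Qed.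

Lemma fidx_nsum k : index_pos k -> cvg_to (fun M => nsum (rev k) (pts q M)) (fidx k).
Proof.
move=> hk; apply: cvg_to_eq (Zq_is_fidx hk) => M M0.
by rewrite ZqM_word1 /ZqM_word /gword -map_rev ZqMrev_nsum.
Qed.

Lemma fval_decode u : wf u -> index_pos (decode (rev u)) /\ fval u = fidx (decode (rev u)).
Proof.
move=> hu; have [|e hp] := @zword_decode (rev u); first by rewrite revK.
by rewrite /fidx e revK.
Qed.

Lemma hat_gword k : index_pos k -> hat (rev (gword k)).
Proof.
rewrite /index_pos -all_rev /gword -map_rev /hat /Aword_valid all_map => -> /=.
by case: (rev k).
Qed.

Lemma Nq_mulf u z : wf u -> Nq_set q z -> Nq_set q (z * fval u).
Proof.
move=> /fval_decode[hk ->] [X [/in_spanP hX zX]]; set k := decode _ in hk *.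
exists (star_fs X [:: (1%Q, 0%N, gword k)]); split; last first.
  by apply: cvg_to_eq (cvg_toM zX (Zq_is_fidx hk)) => M M0; rewrite ZqM_star.
apply/in_spanP => t /flattenP[T /allpairsP[[s r] [/= hs hr ->]]].
move: hr; rewrite inE => /eqP -> /mapP[t' /mapP[t0 ht0 ->] ->] /=.
have hg := hat_gword hk.
have := hX _ hs; rewrite -[s.2]revK => /n_monoP/andP[h1 h2].
apply/n_monoP; apply/andP; split; first exact: (starR_hat ht0).
rewrite addn0; case/orP: h2 => [h2|/(starR_n0 ht0) /orP[h2|->]]; rewrite ?orbT //.
  by rewrite addn_gt0 h2.
by rewrite addn_gt0 h2 orbT.
Qed.

Lemma fval_shuffle a b : wf (Lx :: a) -> wf (Lx :: b) ->
  eqN (Nq_set q) (fval (Lx :: a) * fval (Lx :: b)) (shsum fval (Lx :: a) (Lx :: b)).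
Proof.
move=> ha hb; apply: Nq_inspan (phi_shuffle_x q_lt1 ha hb) _.
apply: csumD.
  exact: (csum_conv q_gt0 q_lt1 (geom_phi q_gt0 q_lt1 _) (geom_phi q_gt0 q_lt1 _) (fvalP _) (fvalP _)).
by apply: csumN; apply: csum_sum => m _; exact: fvalP.
Qed.

(** For a power of y only the cut with empty [p.2] survives, by [reg_ally]. Otherwise, cuts beyond
    the first x do not contribute, and [reg_yx] turns the remaining sum into that of [phi_reg]. *)
Lemma fval_reg u : wf u -> eqN (Nq_set q) (fval u)
  (\sum_(p <- splits u) if ally p.1 then fval p.1 * reg fval p.2 else 0).
Proof.
move=> hu; have [[n eu]|[n [v eu]]] := yx_decomp u.
  apply: (eqN_eq Nq0); case/lastP: u eu {hu} => [|u x] eu.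
    by rewrite big_seq1 reg_nil fval_nil mulr1.
  have hy : ally (rcons u x) by rewrite eu nseq_ally.
  rewrite (splits_rcons (fun a b => if ally a then fval a * reg fval b else 0)) hy.
  rewrite reg_nil fval_nil mulr1 big1_seq ?add0r // => p /andP[_ /mem_splits hp].
  case: ifP => // _; rewrite reg_ally ?mulr0 //; last by case: (p.2).
  by move: hy; rewrite -hp rcons_cat /ally all_cat => /andP[].
have hv : wf (Lx :: v) by apply: (@wf_suffix (nseq n Ly)); rewrite -eu.
have hd := nseq_ally n.
have := Nq_inspan (phi_reg q_lt1 hd hv).
rewrite -eu => /(_ (fval u - \sum_(p <- splits (nseq n Ly)) sgn (size p.2)
   (fval p.1 * shsum (fval \o cons Lx) v p.2))) H.
rewrite (_ : \sum_(p <- splits u) _ = \sum_(p <- splits (nseq n Ly)) sgn (size p.2)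
   (fval p.1 * shsum (fval \o cons Lx) v p.2)).
  apply: H; apply: csumD; first exact: fvalP.
  apply: csumN; apply: csum_sum => p _; apply: csum_sgn.
  rewrite /shsum conv_sumr mulr_sumr; apply: csum_sum => m _ /=.
  exact: (csum_conv q_gt0 q_lt1 (geom_phi q_gt0 q_lt1 _) (geom_phi q_gt0 q_lt1 (Lx :: _)) (fvalP _) (fvalP (Lx :: _))).
rewrite eu (splits_cat_cons (fun a b => if ally a then fval a * reg fval b else 0)).
rewrite [X in _ + X]big1 ?addr0; last first.
  by move=> p _; rewrite /ally all_cat /= andbF.
apply: eq_big_seq => p /mem_splits hp.
have /andP[h1 h2] : ally p.1 && ally p.2 by rewrite -all_cat hp.
by rewrite h1 {1}(ally_nseq h2) reg_yx -(ally_nseq h2) -sgn_mulr.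
Qed.

Lemma fidx_mul k l : index_pos k -> index_pos l ->
  fidx k * fidx l = \sum_(m <- harm k l) fidx m.
Proof.
move=> hk hl; apply: (cvg_to_uniq (cvg_toM (fidx_nsum hk) (fidx_nsum hl))).
have h : cvg_to (fun M => \sum_(m <- harm k l) nsum (rev m) (pts q M)) (\sum_(m <- harm k l) fidx m).
  by apply: cvg_to_sum => m hm; apply: fidx_nsum; exact: (harm_pos hm).
apply: cvg_to_eq h => M _; rewrite -nsum_harmR /harm big_map.
by apply: eq_bigr => m _; rewrite revK.
Qed.

(* The rational span of the values of the admissible indices, a subring of Z_q. *)
Definition Zadm (z : C) : Prop := exists2 s : seq (rat * seq nat),
  (forall t, t \in s -> index_pos t.2 && admissible t.2) &
  z = \sum_(t <- s) ratr t.1 * fidx t.2.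

Lemma Zadm0 : Zadm 0.
Proof. by exists [::] => //; rewrite big_nil. Qed.

Lemma ZadmD a b : Zadm a -> Zadm b -> Zadm (a + b).
Proof.
move=> [s hs ->] [t ht ->]; exists (s ++ t); last by rewrite big_cat.
by move=> x; rewrite mem_cat => /orP[/hs|/ht].
Qed.

Lemma ZadmZ r a : Zadm a -> Zadm (ratr r * a).
Proof.
move=> [s hs ->]; exists [seq (r * t.1, t.2) | t <- s].
  by move=> x /mapP[t /hs h ->].
rewrite big_map mulr_sumr; apply: eq_bigr => t _ /=.
by rewrite rmorphM mulrA.
Qed.

Lemma ZadmN a : Zadm a -> Zadm (- a).
Proof. by move=> /(ZadmZ (-1)); rewrite rmorphN1 mulN1r. Qed.

Lemma Zadm_fidx k : index_pos k -> admissible k -> Zadm (fidx k).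
Proof.
move=> h1 h2; exists [:: (1, k)]; first by move=> t; rewrite inE => /eqP -> /=; rewrite h1.
by rewrite big_seq1 rmorph1 mul1r.
Qed.

Lemma Zadm_sum (I : eqType) (r : seq I) (F : I -> C) :
  (forall i, i \in r -> Zadm (F i)) -> Zadm (\sum_(i <- r) F i).
Proof.
move=> h; rewrite big_seq; elim/big_ind: _ => //; [exact: Zadm0|exact: ZadmD].
Qed.

Lemma ZadmM a b : Zadm a -> Zadm b -> Zadm (a * b).
Proof.
move=> [s hs ->] [t ht ->]; rewrite mulr_suml; apply: Zadm_sum => x /hs /andP[x1 x2].
rewrite mulr_sumr; apply: Zadm_sum => y /ht /andP[y1 y2].
rewrite mulrACA -rmorphM fidx_mul //; apply: ZadmZ; apply: Zadm_sum => m hm.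
by apply: Zadm_fidx; [exact: (harm_pos hm)|exact: (harm_admissible hm)].
Qed.

Lemma Zadm1 : Zadm 1.
Proof. by rewrite -fval_nil; exact: (@Zadm_fidx [::]). Qed.

Lemma Zadm_sgn n a : Zadm a -> Zadm (sgn n a).
Proof. by rewrite /sgn; case: odd => // ?; exact: ZadmN. Qed.

(** The words in [reg_yx] begin with x in reversed order, so they encode admissible indices. *)
Lemma Zadm_reg u : wf u -> Zadm (reg fval u).
Proof.
move=> hu; have [[n eu]|[n [v eu]]] := yx_decomp u; rewrite eu in hu *.
  case: n {eu hu} => [|n]; first by rewrite reg_nil fval_nil; exact: Zadm1.
  by rewrite reg_ally ?nseq_ally //; exact: Zadm0.
have hv := wf_suffix hu; have nv := wf_x hv.
rewrite reg_yx; apply: Zadm_sgn; apply: Zadm_sum => m hm /=.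
have hm' : wf (Lx :: m).
  have := wf_shR hm (wf_behead hv) (wf_ally (nseq_ally n)).
  by have := size_shR hm; case: m {hm} => //; case: (v) nv.
have [h1 ->] := fval_decode hm'.
by apply: Zadm_fidx => //; exact: admissible_decode.
Qed.

Lemma Zadm_Zq z : Zadm z -> Zq_set q z.
Proof.
move=> [s hs ->]; exists [seq (t.1, 0%N, gword t.2) | t <- s]; split.
  apply/in_spanP => t /mapP[x /hs /andP[h1 h2] ->] /=.
  case/lastP: x.2 h1 h2 => [|k n]; first by left.
  rewrite /index_pos => h1; rewrite -[rcons k n]revK admissible_rev rev_rcons => n1.
  right; left; split; first by rewrite /Aword_valid -rev_rcons revK all_map.
  by exists (gword k), n; rewrite -rev_rcons revK /gword map_rcons.
have h : cvg_to (fun M => \sum_(t <- s) ratr t.1 * ZqM q [:: (1%Q, 0%N, gword t.2)] M)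
    (\sum_(t <- s) ratr t.1 * fidx t.2).
  by apply: cvg_to_sum => t /hs /andP[h1 _]; apply: cvg_toZ; exact: Zq_is_fidx.
apply: cvg_to_eq h => M M0; rewrite {2}/ZqM big_map.
by apply: eq_bigr => t _; rewrite ZqM_word1 /= mulr1.
Qed.

(** The ideal of the ring [Zadm] generated by the values at even integers. Products stay inside by
    the exact harmonic product of admissible indices. *)
Definition Pz (z : C) : Prop := exists2 s : seq (C * nat),
  (forall p, p \in s -> Zadm p.1 /\ (0 < p.2)%N) & z = \sum_(p <- s) p.1 * fidx [:: (2 * p.2)%N].

Lemma Pz0 : Pz 0.
Proof. by exists [::] => //; rewrite big_nil. Qed.

Lemma PzD a b : Pz a -> Pz b -> Pz (a + b).
Proof.
move=> [s hs ->] [t ht ->]; exists (s ++ t); last by rewrite big_cat.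
by move=> x; rewrite mem_cat => /orP[/hs|/ht].
Qed.

Lemma PzM a b : Pz a -> Zadm b -> Pz (a * b).
Proof.
move=> [s hs ->] hb; exists [seq (p.1 * b, p.2) | p <- s].
  by move=> x /mapP[p /hs [h1 h2] ->]; split=> //; exact: ZadmM.
rewrite big_map mulr_suml; apply: eq_bigr => p _ /=; by rewrite mulrAC.
Qed.

Lemma Pz_even a m : Zadm a -> (0 < m)%N -> Pz (a * fidx [:: (2 * m)%N]).
Proof.
move=> ha hm; exists [:: (a, m)]; last by rewrite big_seq1.
by move=> x; rewrite inE => /eqP ->.
Qed.

Lemma Zadm_Pz z : Pz z -> Zadm z.
Proof.
move=> [s hs ->]; apply: Zadm_sum => p /hs [h1 h2]; apply: ZadmM => //.
by apply: Zadm_fidx; rewrite /= ?muln_gt0 ?h2 //; case: (p.2) h2 => // n _; rewrite mulnS.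
Qed.

Lemma Pz_NP z : Pz z -> NPq_set q z.
Proof.
move=> [s hs ->]; exists 0, (\sum_(p <- s) p.1 * fidx [:: (2 * p.2)%N]).
split; [exact: Nq0|split]; last by rewrite add0r.
exists [seq (p.1, fidx [:: (2 * p.2)%N]) | p <- s]; split; last by rewrite big_map.
move=> x /mapP[p /hs [h1 h2] ->]; split; first exact: Zadm_Zq.
by exists p.2; split=> //; apply: (@Zq_is_fidx [:: (2 * p.2)%N]); rewrite /= muln_gt0 h2.
Qed.

Lemma symsum_cvg k : index_pos k ->
  cvg_to (ZSqM q k) (symsum fval (Ly :: rev (zword k))).
Proof.
move=> hk; rewrite /symsum (symsum_zword (fun a u => sgn (size a) (fval u * fval (rev a)))).
have h : cvg_to (fun M => \sum_(p <- splits k) (-1) ^+ wt p.2 *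
    (nsum (rev p.1) (pts q M) * nsum p.2 (pts q M)))
  (\sum_(p <- splits k) (-1) ^+ wt p.2 * (fidx p.1 * fidx (rev p.2))).
  apply: cvg_to_sum => p /mem_splits hp; apply: cvg_toZ.
  have /andP[h1 h2] : index_pos p.1 && index_pos p.2 by rewrite -all_cat hp.
  apply: cvg_toM; first exact: fidx_nsum.
  by rewrite -{1}[p.2]revK; apply: fidx_nsum; rewrite /index_pos all_rev.
rewrite (_ : \sum_(p <- splits k) _ = \sum_(p <- splits k) (-1) ^+ wt p.2 * (fidx p.1 * fidx (rev p.2))).
  by apply: cvg_to_eq h => M M0; rewrite ZSqM_sum.
apply: eq_big_seq => p /mem_splits hp.
have /andP[h1 h2] : index_pos p.1 && index_pos p.2 by rewrite -all_cat hp.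
by rewrite sgn_expr size_zword /wt ?sumn_rev // /index_pos all_rev.
Qed.

Lemma rev_zword_ones n : rev (zword (nseq n 1%N)) = nseq n Ly.
Proof.
have -> : zword (nseq n 1%N) = nseq n Ly 
  by elim: n => [//|n IH]; rewrite -[LHS]/(Ly :: zword (nseq n 1%N)) IH.
by rewrite rev_nseq.
Qed.

(* The symmetric value of the index (1, ..., 1), n times. *)
Definition sones (n : nat) : C := symsum fval (nseq n.+1 Ly).

Lemma sones_cvg n : cvg_to (fun M => nsum (nseq n 1%N) (spts q M)) (sones n).
Proof.
have := @symsum_cvg (nseq n 1%N); rewrite rev_zword_ones => h.
apply: cvg_to_eq (h _); last by rewrite /index_pos all_nseq orbT.
by move=> M M0; rewrite ZSqM_nsum // rev_nseq.
Qed.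

Lemma sum_spts k M : \sum_(c <- spts q M) c ^+ k = (1 + (-1) ^+ k) * nsum [:: k] (pts q M).
Proof.
rewrite /spts big_cat -!nsum_letter /= -[[:: k] in X in X + _]/(rev [:: k]) nsum_rev nsum_opp.
by rewrite /= addn0 mulrDl mul1r addrC.
Qed.

(* The odd power sums over [spts] vanish, so only the values at the even integers remain. *)
Lemma sones_newton n : n%:R * sones n =
  \sum_(j < n) (-1) ^+ j * ((1 + (-1) ^+ j.+1) * fidx [:: j.+1]) * sones (n - j.+1).
Proof.
apply: (cvg_to_uniq (cvg_toZ n%:R (sones_cvg n))).
have h : cvg_to (fun M => \sum_(j <- index_enum 'I_n)
    ((-1) ^+ j * (1 + (-1) ^+ j.+1)) * (nsum [:: j.+1] (pts q M) * nsum (nseq (n - j.+1) 1%N) (spts q M)))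
  (\sum_(j <- index_enum 'I_n) ((-1) ^+ j * (1 + (-1) ^+ j.+1)) * (fidx [:: j.+1] * sones (n - j.+1))).
  apply: cvg_to_sum => j _; apply: cvg_toZ; apply: cvg_toM; last exact: sones_cvg.
  exact: (@fidx_nsum [:: j.+1]).
rewrite (_ : \sum_(j < n) _ = \sum_(j <- index_enum 'I_n)
    ((-1) ^+ j * (1 + (-1) ^+ j.+1)) * (fidx [:: j.+1] * sones (n - j.+1))).
  apply: cvg_to_eq h => M _; rewrite nsum_newton; apply: eq_bigr => j _.
  by rewrite sum_spts !mulrA.
by apply: eq_bigr => j _; rewrite !mulrA.
Qed.

Lemma sones0 : sones 0 = 1.
Proof. by rewrite /sones /symsum /= !big_cons big_nil /= fval_nil !addr0 mulr1. Qed.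

(** Strong induction on Newton's identity: each even power sum is multiplied by a [sones] of smaller
    index, which is 1 or already in [Pz], hence in [Zadm]. Division by n + 1 is allowed because
    [Zadm] is a rational vector space. *)
Lemma Pz_sones n : Pz (sones n.+1).
Proof.
have [m] := ubnP n; elim: m n => // m IH n; rewrite ltnS => hn.
have n0 : n.+1%:R != 0 :> C by rewrite pnatr_eq0.
rewrite -[sones _](mulKf n0) sones_newton mulr_sumr.
elim/big_ind: _ => [|a b|j _]; [exact: Pz0|exact: PzD|].
have [oj|ej] := boolP (odd j.+1).
  by rewrite -[(-1) ^+ j.+1]signr_odd oj subrr mul0r mulr0 mul0r mulr0; exact: Pz0.
have ej2 : j.+1 = (2 * j.+1./2)%N.
  by rewrite mul2n -[LHS]odd_double_half (negbTE ej).
have hj : (0 < j.+1./2)%N by case: (j.+1./2) ej2.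
have hz : Zadm (sones (n.+1 - j.+1)).
  rewrite subSS; case e : (n - j)%N => [|i]; first by rewrite sones0; exact: Zadm1.
  apply/Zadm_Pz/IH; apply: leq_trans hn; rewrite -ltnS -e; exact: leq_subr.
rewrite -[(-1) ^+ j.+1]signr_odd (negbTE ej).
rewrite (_ : _ * _ = (ratr (n.+1%:R^-1 * ((-1) ^+ j * 2)) * sones (n.+1 - j.+1)) * fidx [:: j.+1]).
  by rewrite [in fidx _]ej2; apply: Pz_even => //; exact: ZadmZ.
rewrite !rmorphM fmorphV rmorph_nat rmorphXn rmorphN1 rmorph_nat expr0.
by rewrite -[1 + 1]/(2%:R) -!mulrA; congr (_ * _); congr (_ * _); congr (_ * _); rewrite mulrC.
Qed.

Lemma NP_ysum n u v : wf u -> wf v ->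
  NPq_set q (ysum fval (nseq n.+2 Ly) * (reg fval u * reg fval v)).
Proof.
move=> hu hv; apply: Pz_NP.
rewrite (_ : ysum _ _ = sones n.+1).
  by apply: PzM; [exact: Pz_sones|apply: ZadmM; exact: Zadm_reg].
apply: eq_big_seq => p /mem_splits hp.
have /andP[h1 h2] : ally p.1 && ally p.2 by rewrite -all_cat hp; exact: nseq_ally.
by rewrite (rev_ally h1); case: p.2 => [|[] s] //=; rewrite mulrC.
Qed.

Lemma NPq_N z : Nq_set q z -> NPq_set q z.
Proof.
move=> h; exists z, 0; split=> //; split; last by rewrite addr0.
by exists [::]; split=> //; rewrite big_nil.
Qed.

Lemma NPqD a b : NPq_set q a -> NPq_set q b -> NPq_set q (a + b).
Proof.
move=> [n [p [hn [[s [hs ep]] ->]]]] [n' [p' [hn' [[s' [hs' ep']] ->]]]].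
exists (n + n'), (p + p'); split; first exact: NqD.
split; last by rewrite addrACA.
exists (s ++ s'); split; last by rewrite big_cat ep ep'.
by move=> x; rewrite mem_cat => /orP[/hs|/hs'].
Qed.

Lemma Zq_setN z : Zq_set q z -> Zq_set q (- z).
Proof.
move=> [X [/in_spanP hX zX]]; exists (fs_opp X); split.
  by apply/in_spanP => t /mapP[r /hX hr ->].
by apply: cvg_to_eq (cvg_toN zX) => M _; rewrite ZqM_opp.
Qed.

Lemma NPqN a : NPq_set q a -> NPq_set q (- a).
Proof.
move=> [n [p [hn [[s [hs ep]] ->]]]]; exists (- n), (- p); split; first exact: NqN.
split; last by rewrite opprD.
exists [seq (- x.1, x.2) | x <- s]; split.
  by move=> x /mapP[y /hs [h1 h2] ->]; split=> //; exact: Zq_setN.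
by rewrite ep big_map -sumrN; apply: eq_bigr => x _; rewrite mulNr.
Qed.

End Values.

(** * The two relations *)

Lemma zword_rev l : Ly :: rev (zword (rev l)) = rcons (zword l) Ly.
Proof.
elim: l => [//|n l IH].
rewrite rev_cons zword_rcons rev_cat rev_cons rev_nseq cat_rcons IH /=.
by rewrite rcons_cat.
Qed.

Theorem theorem6p6 (R : realType) (q : R[i])
  (hq0 : 0 < `|q|) (hq1 : `|q| < 1)
  (zetaS : seq nat -> R[i])
  (hzetaS : forall m : seq nat, index_pos m -> Zq_is q (wS_word (gword m)) (zetaS m))
  (k l : seq nat) (hk : index_pos k) (hl : index_pos l) :
  eq_mod_NP q (zetaS k * zetaS l) (\sum_(m <- harm k l) zetaS m)
  /\ (admissible k || admissible l ->
      eq_mod_NP q ((-1) ^+ wt l * zetaS (k ++ rev l))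
                  (\sum_(m <- shuffle_idx k l) zetaS m)).
Proof.
split=> [|_].
  (* The harmonic relation is an equality of complex numbers, so the difference is the zero element
     of N_q. *)
  rewrite /eq_mod_NP (_ : _ * _ = \sum_(m <- harm k l) zetaS m).
    by rewrite subrr; apply/NPq_N/Nq0.
  apply: (cvg_to_uniq (cvg_toM (hzetaS _ hk) (hzetaS _ hl))).
  have h : cvg_to (fun M => \sum_(m <- harm k l) ZSqM q m M) (\sum_(m <- harm k l) zetaS m).
    by apply: cvg_to_sum => m hm; apply: hzetaS; exact: (harm_pos hm).
  by apply: cvg_to_eq h => M M0; rewrite ZSqM_harm.
have zE m : index_pos m -> zetaS m = symsum (fval hq0 hq1) (Ly :: rev (zword m)).
  by move=> hm; exact: (cvg_to_uniq (hzetaS _ hm) (symsum_cvg hq0 hq1 hm)).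
set a := rev (zword k); set b := rev (zword l).
rewrite /eq_mod_NP.
have -> : \sum_(m <- shuffle_idx k l) zetaS m =
    shsum (fun m => symsum (fval hq0 hq1) (Ly :: m)) a b.
  rewrite /shuffle_idx /sh !big_map; apply: eq_big_seq => m hm.
  have hwf := wf_shR hm (wf_rev_zword _) (wf_rev_zword _).
  have [|e hp] := @zword_decode (rev m); first by rewrite revK.
  by rewrite zE // e revK.
rewrite zE; last by rewrite /index_pos all_cat all_rev; apply/andP.
(* Reversing a word moves each y from the start of its block to the end. The adjoined y compensates
   for this shift: reversing the index l amounts to reversing the letters of z_l y. *)
have -> : Ly :: rev (zword (k ++ rev l)) = rev b ++ Ly :: a.
  rewrite /zword map_cat flatten_cat rev_cat -/(zword _) -/(zword _) -cat_cons zword_rev.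
  by rewrite cat_rcons /b revK.
(* The weight of l is the length of z_l, so the sign of the relation is that of the antipode. *)
rewrite -sgn_expr -(size_zword hl) -(size_rev (zword l)) -/b.
apply: (symsum_shuffle_mod (N := Nq_set q)); try exact: wf_rev_zword.
- exact: Nq0.
- exact: NqD.
- exact: NqN.
- exact: fval_nil.
- exact: Nq_mulf.
- exact: fval_shuffle.
- exact: fval_reg.
- exact: NPq_N.
- exact: NPqD.
- exact: NPqN.
exact: NP_ysum.
Qed.
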